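(* There exists an absolute constant $\gamma>0$ such that the following holds. Let $\mathfrak M=(\mathcal M,\rho)$ be a pseudometric space, and let $G$ be a set-valued mapping assigning to each $x\in\mathcal M$ a non-empty convex compact set $G(x)\subset\mathbf R^2$. For each $x\in\mathcal M$ fix a family $\mathbb H_G(x)$ of closed half-planes such that $G(x)=\bigcap\{H:H\in\mathbb H_G(x)\}$. Then $G$ has a Lipschitz selection if and only if there exists a constant $\lambda\ge0$ such that for every four (not necessarily distinct) elements $x,x',y,y'\in\mathcal M$ and every four half-planes $H_1\in\mathbb H_G(x)$, $H_2\in\mathbb H_G(x')$, $H_3\in\mathbb H_G(y)$, $H_4\in\mathbb H_G(y')$, $$\operatorname{dist}(H_1\cap H_2,H_3\cap H_4)\le\lambda\left(\frac{\rho(x,x')}{\sin\varphi(H_1,H_2)}+\frac{\rho(y,y')}{\sin\varphi(H_3,H_4)}+\operatorname{diam}_\rho\{x,x',y,y'\}\right).$$ Furthermore, $\frac1{\sqrt2}\inf\lambda\le|G|_{\mathfrak M}\le\gamma\inf\lambda$, where the infimum is over all such $\lambda$.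
   Context: A pseudometric space $\mathfrak M=(\mathcal M,\rho)$ is a set with $\rho:\mathcal M\times\mathcal M\to[0,+\infty]$ such that $\rho(x,x)=0$, $\rho(x,y)=\rho(y,x)$, $\rho(x,y)\le\rho(x,z)+\rho(z,y)$; $\rho(x,y)=0$ with $x\ne y$ and $\rho(x,y)=+\infty$ are allowed. We read $\lambda\cdot(+\infty)=+\infty$ for every $\lambda\ge0$; also $0/0=0$ and $a/0=+\infty$ for $a>0$. $\mathbf R^2$ carries the uniform norm $\|x\|=\max\{|x_1|,|x_2|\}$, and $\operatorname{dist}(A,B)=\inf\{\|a-b\|:a\in A,b\in B\}$, with $\operatorname{dist}(\emptyset,A)=\operatorname{dist}(A,\emptyset)=0$ for every $A\subset\mathbf R^2$. For $f:\mathcal M\to\mathbf R^2$, $\|f\|_{\mathrm{Lip}(\mathcal M)}=\inf\{\lambda\ge0:\|f(x)-f(y)\|\le\lambda\rho(x,y)\ \forall x,y\in\mathcal M\}$ ($\inf\emptyset=+\infty$); $f$ is Lipschitz if this is finite. A selection of $G$ is a map $f:\mathcal M\to\mathbf R^2$ with $f(x)\in G(x)$ for all $x$. $|G|_{\mathfrak M}$ is the infimum of $\|f\|_{\mathrm{Lip}(\mathcal M)}$ over all Lipschitz selections $f$ of $G$, and $+\infty$ if there are none. $\varphi(H,H')\in[0,\pi/2]$ is the angle between the boundary lines of the half-planes $H$ and $H'$ ($0$ if parallel). $\operatorname{diam}_\rho$ is the diameter with respect to $\rho$. *)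

(* Defs.v *)
From HB Require Import structures.
From mathcomp Require Import all_boot all_order all_algebra.
From mathcomp Require Import all_classical all_reals all_analysis.
Set Implicit Arguments.
Unset Strict Implicit.
Unset Printing Implicit Defensive.
Import Order.TTheory GRing.Theory Num.Theory.
Import numFieldNormedType.Exports.
Local Open Scope classical_set_scope.
Local Open Scope ring_scope.

(* R^2 is 'rV[R]_2: its canonical norm `|x| is the uniform norm. *)

Section Plane.
Variable R : realType.

Definition dot (u v : 'rV[R]_2) : R := \sum_i u ord0 i * v ord0 i.

Definition enorm (u : 'rV[R]_2) : R := Num.sqrt (dot u u).

Record halfplane := Halfplane {
  hp_normal : 'rV[R]_2;
  hp_offset : R;
  hp_normal_neq0 : hp_normal != 0
}.

Definition hp_set (H : halfplane) : set 'rV[R]_2 :=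
  [set z | dot (hp_normal H) z <= hp_offset H].

Definition hp_direction (H : halfplane) : 'rV[R]_2 :=
  let n := hp_normal H in
  \row_j (if j == ord0 then - n ord0 ord_max else n ord0 ord0).

(* The angle in [0, pi/2] between the lines R u and R v, for u, v nonzero. *)
Definition line_angle (u v : 'rV[R]_2) : R :=
  acos (`|dot u v| / (enorm u * enorm v)).

Definition hp_angle (H H' : halfplane) : R :=
  line_angle (hp_direction H) (hp_direction H').

(* The library has inf set0 = 0, so this is 0 when A or B is empty. *)
Definition set_dist (A B : set 'rV[R]_2) : R :=
  inf [set `|a - b| | a in A & b in B].

End Plane.

Section Pseudometric.
Variables (R : realType) (M : Type).
Implicit Type rho : M -> M -> \bar R.

Record is_pseudometric rho : Prop := IsPseudometric {
  pm_ge0 : forall x y, (0 <= rho x y)%E;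
  pm_refl : forall x, rho x x = 0%E;
  pm_sym : forall x y, rho x y = rho y x;
  pm_triangle : forall x y z, (rho x y <= rho x z + rho z y)%E
}.

(* Meant for nonempty A only: ereal_sup set0 = -oo. *)
Definition diam rho (A : set M) : \bar R :=
  ereal_sup [set rho a b | a in A & b in A].

(* l * a with l * +oo = +oo also for l = 0, unlike the library product. *)
Definition scale_infty (l : R) (a : \bar R) : \bar R :=
  if a == +oo%E then +oo%E else (l%:E * a)%E.

Definition lip_bound rho (f : M -> 'rV[R]_2) (l : R) : Prop :=
  0 <= l /\ forall x y, (`|f x - f y|%:E <= scale_infty l (rho x y))%E.

Definition lip_seminorm rho (f : M -> 'rV[R]_2) : \bar R :=
  ereal_inf [set l%:E | l in lip_bound rho f].

Definition lipschitz_map rho (f : M -> 'rV[R]_2) : Prop :=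
  (lip_seminorm rho f < +oo)%E.

Definition selection (G : M -> set 'rV[R]_2) (f : M -> 'rV[R]_2) : Prop :=
  forall x, G x (f x).

Definition lip_selection rho (G : M -> set 'rV[R]_2) (f : M -> 'rV[R]_2) : Prop :=
  selection G f /\ lipschitz_map rho f.

Definition selection_seminorm rho (G : M -> set 'rV[R]_2) : \bar R :=
  ereal_inf [set lip_seminorm rho f | f in lip_selection rho G].

(* The library division on \bar R has 0 / 0 = 0 and a / 0 = +oo for a > 0. *)
Definition halfplane_condition rho (HG : M -> set (halfplane R)) (l : R) : Prop :=
  forall (x x' y y' : M) (H1 H2 H3 H4 : halfplane R),
    HG x H1 -> HG x' H2 -> HG y H3 -> HG y' H4 ->
    ((set_dist (hp_set H1 `&` hp_set H2) (hp_set H3 `&` hp_set H4))%:E <=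
     scale_infty l
       (rho x x' / (sin (hp_angle H1 H2))%:E
        + rho y y' / (sin (hp_angle H3 H4))%:E
        + diam rho [set z | [\/ z = x, z = x', z = y | z = y']]))%E.

End Pseudometric.

(* Main.v *)
Require Import Defs.
From HB Require Import structures.
From mathcomp Require Import all_boot all_order all_algebra.
From mathcomp Require Import all_classical all_reals all_analysis.
From mathcomp Require Import ring lra.
Import Order.TTheory GRing.Theory Num.Theory.
Import numFieldNormedType.Exports.
Local Open Scope classical_set_scope.
Local Open Scope ring_scope.
Set Implicit Arguments.
Unset Strict Implicit.
Unset Printing Implicit Defensive.

(** Necessity is elementary: if [f] is a selection with constant [l], slide
    [f x] parallel to the boundary of [H1] until it lies on the parallel to the
    boundary of [H2] through [f x'].  The Euclidean length of the slide is the
    distance from [f x] to this parallel, divided by the sine of the angle;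
    passing from the uniform to the Euclidean norm costs the factor [sqrt 2]
    ([wedge_near_selection], [condition_of_selection]).

    Sufficiency.  Each half-plane is written [p x + q y >= c] with
    [|p| + |q| = 1], so that thickening it by [r] in the uniform norm replaces
    [c] by [c - r], and the metric is scaled by [l].  Take nonnegative
    coefficients with [a1 n1 + a2 n2 = u = - (a3 n3 + a4 n4)].  The form [u] is at
    least [a1 c1 + a2 c2] on the first wedge and at most [- (a3 c3 + a4 c4)] on the
    second, so the condition bounds [a1 c1 + a2 c2 + a3 c3 + a4 c4] by a multiple
    of [|u| (rho12 / |n1 x n2| + rho34 / |n3 x n4| + rho13)].  These bounds
    degrade as the angles shrink.  They are first turned into bounds on
    [sum a_i c_i] by the sum of the [a_i rho(x, x_i)], in which no angle occurs.
    For three half-planes with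
    [a1 n1 + a2 n2 + a3 n3 = 0] the wedges that share the half-plane of the
    longest side of the triangle with these normals do the job, for the form [u]
    orthogonal to [n3] ([triangle_longest], [triangle_bound]).  For four, the
    relation between the normals is split into two relations between three of
    them ([split_relation]), which cuts [u] into [u' + u''].  If the two pieces
    hardly cancel, the triangle bounds add up.  Otherwise one keeps the part of
    the longer piece along itself, and the remainder, orthogonal to it, is so
    short that the wedge bound for it loses nothing: its length is at most
    [2 a_i |n1 x n2|] ([quad_bound_of_cut], [quad_bound]).

    The selection is then explicit.  At [x] every half-plane of every point [z]
    is kept, thickened by [64 rho(x, z)].  Combining two of these inequalities
    so as to cancel one coordinate (Fourier-Motzkin elimination) gives lower and
    upper bounds for the other one, and [quad_bound] says exactly that a lower
    bound at [x] exceeds an upper bound at [y] by at most [64 rho(x, y)].  So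
    McShane's formula yields Lipschitz functions [g1], [g2] that respect all
    these bounds ([axis_selection]): [(g1 x, g2 x)] lies in the smallest
    rectangle containing the set cut out at [x].  This point is moved into
    the set along a diagonal.  For each of the four quadrants let the corner be
    the largest violation, at [(g1 x, g2 x)], of an inequality whose normal lies
    in that quadrant.  As a supremum of uniformly Lipschitz functions it is
    Lipschitz in [x], at most one of the four is positive, and moving by it in
    the direction [(+-1, +-1)] of its quadrant repairs all the inequalities at
    once ([corner_sum_ge], [lipschitz_selection_of_combs]). *)

(** * Comparison of norms, and splitting of linear relations *)

(** An extended pseudometric seen on its components: [near] says that the
    distance is finite, and [d] is meaningful for near points only. *)
Record local_metric (R : realType) (M : Type)
    (near : M -> M -> Prop) (d : M -> M -> R) : Prop := LocalMetric {
  near_refl : forall x, near x x;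
  near_sym : forall x y, near x y -> near y x;
  near_trans : forall x y z, near x y -> near y z -> near x z;
  lm_ge0 : forall x y, 0 <= d x y;
  lm_refl : forall x, d x x = 0;
  lm_sym : forall x y, d x y = d y x;
  lm_triangle : forall x y z, near x z -> near z y -> d x y <= d x z + d z y }.

Section NormComparison.
Variable R : realType.
Implicit Types u v : R.

Lemma l1_unit_sqr_ge u v : `|u| + `|v| = 1 -> 1 <= 2 * (u ^+ 2 + v ^+ 2).
Proof.
move=> h; rewrite -(real_normK (num_real u)) -(real_normK (num_real v)).
have -> : `|v| = 1 - `|u| by lra.
have := sqr_ge0 (2 * `|u| - 1); nra.
Qed.

Lemma l1_sqr_le u v : (`|u| + `|v|) ^+ 2 <= 2 * (u ^+ 2 + v ^+ 2).
Proof.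
rewrite -(real_normK (num_real u)) -(real_normK (num_real v)).
have := sqr_ge0 (`|u| - `|v|); nra.
Qed.

Lemma sqr_le_l1 u v : u ^+ 2 + v ^+ 2 <= (`|u| + `|v|) ^+ 2.
Proof.
rewrite -(real_normK (num_real u)) -(real_normK (num_real v)).
have := mulr_ge0 (normr_ge0 u) (normr_ge0 v); nra.
Qed.

End NormComparison.

Section SplitRelation.
Variable R : realFieldType.
Implicit Types a b p q : R.

(** The ratio test of the simplex method: walk from the point [a] in the
    direction [- b] until a coordinate vanishes. *)
Lemma ratio_test a1 a2 a3 b1 b2 b3 : 0 < a1 -> 0 < a2 -> 0 < a3 ->
  [|| 0 < b1, 0 < b2 | 0 < b3] -> exists t : R, [/\ 0 < t,
    [/\ t * b1 <= a1, t * b2 <= a2 & t * b3 <= a3] &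
    (a1 - t * b1) * (a2 - t * b2) * (a3 - t * b3) = 0].
Proof.
move=> a1p a2p a3p bp.
pose m := Num.max (b1 / a1) (Num.max (b2 / a2) (b3 / a3)).
have m0 : 0 < m.
  by rewrite /m !lt_max; case/or3P: bp => h; rewrite (divr_gt0 h) ?orbT.
have le a b : 0 < a -> b / a <= m -> m^-1 * b <= a.
  by move=> ap; rewrite ler_pdivrMr // ler_pdivrMl.
exists m^-1; split; first by rewrite invr_gt0.
  by split; apply: le => //; rewrite /m !le_max lexx ?orbT.
have eq a b : 0 < a -> m = b / a -> a - m^-1 * b = 0.
  move=> ap mE; apply/eqP; rewrite subr_eq0; apply/eqP.
  apply: (mulfI (lt0r_neq0 m0)); rewrite mulrA divff ?lt0r_neq0 // mul1r.
  by rewrite mE divfK ?lt0r_neq0.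
have [h|h] := leP (Num.max (b2 / a2) (b3 / a3)) (b1 / a1).
  by rewrite (eq a1 b1) // ?mul0r // /m; apply/max_idPl.
have [h'|h'] := leP (b3 / a3) (b2 / a2).
  rewrite (eq a2 b2) // ?mulr0 ?mul0r // /m.
  by move: h; rewrite (max_idPl h') => /ltW/max_idPr.
rewrite (eq a3 b3) // ?mulr0 // /m.
by move: h; rewrite (max_idPr (ltW h')) => /ltW/max_idPr.
Qed.

(** Conic Caratheodory: three of the four planar vectors satisfy a second
    linear relation, and walking from [a] along it, forwards and backwards, one
    leaves the positive orthant at two points whose convex hull contains [a]. *)
Lemma split_relation p1 p2 p3 p4 q1 q2 q3 q4 a1 a2 a3 a4 :
  0 <= a1 -> 0 <= a2 -> 0 <= a3 -> 0 <= a4 ->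
  a1 * p1 + a2 * p2 + a3 * p3 + a4 * p4 = 0 ->
  a1 * q1 + a2 * q2 + a3 * q3 + a4 * q4 = 0 ->
  p1 * q2 - q1 * p2 != 0 ->
  exists b1 b2 b3 b4 : R,
    [/\ [/\ 0 <= b1 <= a1, 0 <= b2 <= a2, 0 <= b3 <= a3 & 0 <= b4 <= a4],
        b1 * p1 + b2 * p2 + b3 * p3 + b4 * p4 = 0,
        b1 * q1 + b2 * q2 + b3 * q3 + b4 * q4 = 0,
        b1 * b2 * b3 * b4 = 0 &
        (a1 - b1) * (a2 - b2) * (a3 - b3) * (a4 - b4) = 0].
Proof.
move=> a10 a20 a30 a40 hp hq x12.
have [a0|a0] := eqVneq (a1 * a2 * a3 * a4) 0.
  by exists 0, 0, 0, 0; split; rewrite ?lexx ?mul0r ?addr0 ?subr0.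
move: a0; rewrite !mulf_eq0 !negb_or -!andbA => /and4P[n1 n2 n3 n4].
have a1p : 0 < a1 by rewrite lt_def n1.
have a2p : 0 < a2 by rewrite lt_def n2.
have a3p : 0 < a3 by rewrite lt_def n3.
(* Cramer's relation between the first three vectors, up to sign *)
have [b1 [b2 [b3 [b3p bp bq]]]] : exists b1 b2 b3, [/\ 0 < b3,
    b1 * p1 + b2 * p2 + b3 * p3 = 0 & b1 * q1 + b2 * q2 + b3 * q3 = 0].
  have [xp|xp] := ltP 0 (p1 * q2 - q1 * p2).
    exists (p2 * q3 - q2 * p3), (p3 * q1 - q3 * p1), (p1 * q2 - q1 * p2).
    by split=> //; ring.
  exists (- (p2 * q3 - q2 * p3)), (- (p3 * q1 - q3 * p1)), (- (p1 * q2 - q1 * p2)).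
  by split; [rewrite oppr_gt0 lt_def eq_sym x12|ring|ring].
have [t [t0 [t1 t2 t3] tz]] :
    exists t : R, [/\ 0 < t, [/\ t * b1 <= a1, t * b2 <= a2 & t * b3 <= a3] &
      (a1 - t * b1) * (a2 - t * b2) * (a3 - t * b3) = 0].
  by apply: ratio_test => //; rewrite b3p !orbT.
have [/andP[b10 b20]|bn] := boolP ((0 <= b1) && (0 <= b2)).
  exists (t * b1), (t * b2), (t * b3), 0.
  split; rewrite ?mulr0 ?subr0 ?tz ?mul0r //.
  - by rewrite t1 t2 t3 lexx a40 !mulr_ge0 // ltW.
  - by rewrite addr0 -!mulrA -!mulrDr bp mulr0.
  - by rewrite addr0 -!mulrA -!mulrDr bq mulr0.
have [s [s0 [s1 s2 s3] sz]] :
    exists s : R, [/\ 0 < s, [/\ s * - b1 <= a1, s * - b2 <= a2 & s * - b3 <= a3] &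
      (a1 - s * - b1) * (a2 - s * - b2) * (a3 - s * - b3) = 0].
  by apply: ratio_test => //; move: bn; rewrite negb_and -!ltNge !oppr_gt0 => /orP[] ->; rewrite ?orbT.
have ts : 0 < t + s by rewrite addr_gt0.
have tsn := lt0r_neq0 ts.
pose m := s / (t + s).
have m0 : 0 <= m by rewrite divr_ge0 ?ltW.
have mE a b : a - m * (a - t * b) = t / (t + s) * (a - s * - b).
  by rewrite /m; field.
have m1 : 0 <= t / (t + s) by rewrite divr_ge0 ?ltW.
have in_range a b : t * b <= a -> s * - b <= a -> 0 <= m * (a - t * b) <= a.
  move=> h1 h2; rewrite mulr_ge0 ?subr_ge0 //= -subr_ge0 mE mulr_ge0 ?subr_ge0 //.
exists (m * (a1 - t * b1)), (m * (a2 - t * b2)), (m * (a3 - t * b3)), (m * (a4 - t * 0)).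
split.
- by rewrite !in_range // ?oppr0 mulr0.
- have -> : m * (a1 - t * b1) * p1 + m * (a2 - t * b2) * p2 + m * (a3 - t * b3) * p3 +
      m * (a4 - t * 0) * p4 = m * (a1 * p1 + a2 * p2 + a3 * p3 + a4 * p4) -
      m * t * (b1 * p1 + b2 * p2 + b3 * p3) by ring.
  by rewrite hp bp !mulr0 subrr.
- have -> : m * (a1 - t * b1) * q1 + m * (a2 - t * b2) * q2 + m * (a3 - t * b3) * q3 +
      m * (a4 - t * 0) * q4 = m * (a1 * q1 + a2 * q2 + a3 * q3 + a4 * q4) -
      m * t * (b1 * q1 + b2 * q2 + b3 * q3) by ring.
  by rewrite hq bq !mulr0 subrr.
- transitivity (m ^+ 4 * ((a1 - t * b1) * (a2 - t * b2) * (a3 - t * b3)) * a4); first by ring.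
  by rewrite tz mulr0 mul0r.
- rewrite !mE; set w := t / (t + s).
  transitivity (w ^+ 4 * ((a1 - s * - b1) * (a2 - s * - b2) * (a3 - s * - b3)) * a4); first by ring.
  by rewrite sz mulr0 mul0r.
Qed.

End SplitRelation.

Definition normal_cross (R : realType) (J : Type) (p q : J -> R) i j :=
  p i * q j - q i * p j.

(** * From wedges to angle-free inequalities *)

Section Certificates.
Variables (R : realType) (M J : Type) (near : M -> M -> Prop) (d : M -> M -> R).
Variables (site : J -> M) (p q c : J -> R).
Hypothesis dM : local_metric near d.
Hypothesis unit_normal : forall j, `|p j| + `|q j| = 1.

Local Notation cross := (normal_cross p q).

Hypothesis antiparallel_bound : forall i j, near (site i) (site j) ->
  p i = - p j -> q i = - q j -> c i + c j <= d (site i) (site j).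

(** The four half-planes condition in dual form, for the linear form with
    coefficients [a1 n_i + a2 n_j]. *)
Hypothesis wedge_bound : forall i j k l (a1 a2 a3 a4 : R),
  near (site i) (site j) -> near (site i) (site k) -> near (site k) (site l) ->
  cross i j != 0 -> cross k l != 0 ->
  0 <= a1 -> 0 <= a2 -> 0 <= a3 -> 0 <= a4 ->
  a1 * p i + a2 * p j + a3 * p k + a4 * p l = 0 ->
  a1 * q i + a2 * q j + a3 * q k + a4 * q l = 0 ->
  a1 * c i + a2 * c j + a3 * c k + a4 * c l <=
    (`|a1 * p i + a2 * p j| + `|a1 * q i + a2 * q j|) *
    (2 * (d (site i) (site j) / `|cross i j|) +
     2 * (d (site k) (site l) / `|cross k l|) + d (site i) (site k)).

Lemma antiparallel_scaled i j a b : near (site i) (site j) -> 0 <= a -> 0 <= b ->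
  a * p i + b * p j = 0 -> a * q i + b * q j = 0 ->
  a * c i + b * c j <= a * d (site i) (site j).
Proof.
move=> nij a0 b0 hp hq.
have hp' : a * p i = - (b * p j) by lra.
have hq' : a * q i = - (b * q j) by lra.
have eab : a = b.
  have : a * (`|p i| + `|q i|) = b * (`|p j| + `|q j|).
    by rewrite !mulrDr -{1 2}(ger0_norm a0) -{1 2}(ger0_norm b0) -!normrM hp' hq' !normrN.
  by rewrite !unit_normal !mulr1.
subst b; have [->|an0] := eqVneq a 0; first by rewrite !mul0r addr0.
rewrite -mulrDr ler_wpM2l // antiparallel_bound //; apply: (mulfI an0); lra.
Qed.

(** The vectors [a n_i], [b n_j], [e n_k] are the sides of a triangle, turned by
    a right angle; the angles at the ends of its longest side are acute. *)
Lemma longest_side_dot i j k a b e : 0 <= a -> 0 <= e ->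
  a * p i + b * p j + e * p k = 0 -> a * q i + b * q j + e * q k = 0 ->
  a ^+ 2 * (p i ^+ 2 + q i ^+ 2) <= e ^+ 2 * (p k ^+ 2 + q k ^+ 2) ->
  b ^+ 2 * (p j ^+ 2 + q j ^+ 2) <= e ^+ 2 * (p k ^+ 2 + q k ^+ 2) ->
  a * (p i * p k + q i * q k) <= 0.
Proof.
move=> a0 e0 hp hq hi hj.
have [e00|en0] := eqVneq e 0.
  have ni := l1_unit_sqr_ge (unit_normal i).
  suff -> : a = 0 by rewrite mul0r.
  apply/eqP; rewrite -sqrf_eq0; apply/eqP.
  have := sqr_ge0 a; move: hi; rewrite e00; nra.
have egt0 : 0 < e by rewrite lt_def en0.
rewrite -(pmulr_rle0 _ egt0).
have hbp : b * p j = - (a * p i + e * p k) by lra.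
have hbq : b * q j = - (a * q i + e * q k) by lra.
move: hj; rewrite mulrDr -!exprMn hbp hbq => hj.
have := sqr_ge0 (a * p i); have := sqr_ge0 (a * q i); nra.
Qed.

(** Apply the wedge bound to the wedges [k, i] and [k, j] and to the part of
    [a n_i] orthogonal to [n_k].  The length of this form is comparable to both
    [a |n_i x n_k|] and [b |n_j x n_k|], which cancels the two sines. *)
Lemma triangle_longest i j k a b e :
  near (site i) (site k) -> near (site j) (site k) ->
  0 <= a -> 0 <= b -> 0 <= e ->
  a * p i + b * p j + e * p k = 0 -> a * q i + b * q j + e * q k = 0 ->
  a ^+ 2 * (p i ^+ 2 + q i ^+ 2) <= e ^+ 2 * (p k ^+ 2 + q k ^+ 2) ->
  b ^+ 2 * (p j ^+ 2 + q j ^+ 2) <= e ^+ 2 * (p k ^+ 2 + q k ^+ 2) ->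
  a * c i + b * c j + e * c k <=
    4 * (a * d (site i) (site k) + b * d (site j) (site k)).
Proof.
move=> nik njk a0 b0 e0 hp hq hi hj.
set N := p k ^+ 2 + q k ^+ 2 in hi hj *.
have N2 : 1 <= 2 * N by exact: l1_unit_sqr_ge.
have N0 : 0 < N by lra.
have doti := longest_side_dot a0 e0 hp hq hi hj.
have dotj : b * (p j * p k + q j * q k) <= 0.
  apply: (@longest_side_dot j i k b a e) => //; lra.
(* g n_k is the part of a n_i + g n_k that makes it orthogonal to n_k. *)
pose g := - (a * (p i * p k + q i * q k)) / N.
have g0 : 0 <= g by rewrite divr_ge0 ?oppr_ge0 // ltW.
have eg : e - g = - (b * (p j * p k + q j * q k)) / N.
  apply: (mulIf (lt0r_neq0 N0)); rewrite mulrBl /g !divfK ?lt0r_neq0 //.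
  rewrite /N; have -> : e * (p k ^+ 2 + q k ^+ 2) = (e * p k) * p k + (e * q k) * q k by ring.
  have -> : e * p k = - (a * p i + b * p j) by lra.
  have -> : e * q k = - (a * q i + b * q j) by lra.
  by ring.
have eg0 : 0 <= e - g by rewrite eg divr_ge0 ?oppr_ge0 // ltW.
pose X := cross k i; pose Y := cross k j.
have up : g * p k + a * p i = - (a * X) * q k / N.
  apply: (mulIf (lt0r_neq0 N0)); rewrite mulrDl divfK ?lt0r_neq0 //.
  rewrite {1}/g mulrAC divfK ?lt0r_neq0 // /X /normal_cross /N; ring.
have uq : g * q k + a * q i = (a * X) * p k / N.
  apply: (mulIf (lt0r_neq0 N0)); rewrite mulrDl divfK ?lt0r_neq0 //.
  rewrite {1}/g mulrAC divfK ?lt0r_neq0 // /X /normal_cross /N; ring.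
have XY : a * X = - (b * Y).
  rewrite /X /Y /normal_cross.
  have -> : a * (p k * q i - q k * p i) = p k * (a * q i) - q k * (a * p i) by ring.
  have -> : a * q i = - (b * q j + e * q k) by lra.
  have -> : a * p i = - (b * p j + e * p k) by lra.
  by ring.
have dik := lm_ge0 dM (site i) (site k); have djk := lm_ge0 dM (site j) (site k).
have adik := mulr_ge0 a0 dik; have bdjk := mulr_ge0 b0 djk.
have [aX0|aXn0] := eqVneq (a * X) 0.
  have h1 : a * c i + g * c k <= a * d (site i) (site k).
    apply: antiparallel_scaled => //.
      by move: up; rewrite aX0; lra.
    by move: uq; rewrite aX0; lra.
  have h2 : b * c j + (e - g) * c k <= b * d (site j) (site k).
    apply: antiparallel_scaled => //.
      by move: up; rewrite aX0; lra.
    by move: uq; rewrite aX0; lra.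
  lra.
have Xn0 : X != 0 by apply: contra_neq aXn0 => ->; rewrite mulr0.
have Yn0 : Y != 0 by apply: contra_neq aXn0 => Y0; rewrite XY Y0 mulr0 oppr0.
have := @wedge_bound k i k j g a (e - g) b (near_sym dM nik) (near_refl dM _)
  (near_sym dM njk) Xn0 Yn0 g0 a0 eg0 b0.
have -> : g * p k + a * p i + (e - g) * p k + b * p j = 0 by lra.
have -> : g * q k + a * q i + (e - g) * q k + b * q j = 0 by lra.
move=> /(_ erefl erefl); rewrite up uq (lm_refl dM) addr0.
rewrite (lm_sym dM (site k) (site i)) (lm_sym dM (site k) (site j)) -/X -/Y.
have -> : `|- (a * X) * q k / N| + `|a * X * p k / N| = `|a * X| / N.
  rewrite !normrM normrN !normrM normfV (gtr0_norm N0).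
  by rewrite -mulrDl -mulrDr [_ + `|p k|]addrC unit_normal mulr1.
have eX : `|a * X| = a * `|X| by rewrite normrM ger0_norm.
have eY : `|a * X| = b * `|Y| by rewrite XY normrN normrM ger0_norm.
have Ninv : N^-1 <= 2 by rewrite -[N^-1]mul1r ler_pdivrMr.
have h1 : `|a * X| / N * (2 * (d (site i) (site k) / `|X|)) <= 4 * (a * d (site i) (site k)).
  rewrite eX; have -> : a * `|X| / N * (2 * (d (site i) (site k) / `|X|)) =
     N^-1 * (2 * (a * d (site i) (site k))).
    by field; rewrite normr_eq0 Xn0 lt0r_neq0.
  have := ler_wpM2r adik Ninv; lra.
have h2 : `|a * X| / N * (2 * (d (site j) (site k) / `|Y|)) <= 4 * (b * d (site j) (site k)).
  rewrite eY; have -> : b * `|Y| / N * (2 * (d (site j) (site k) / `|Y|)) =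
     N^-1 * (2 * (b * d (site j) (site k))).
    by field; rewrite normr_eq0 Yn0 lt0r_neq0.
  have := ler_wpM2r bdjk Ninv; lra.
rewrite mulrDr; lra.
Qed.


(** The coefficient of the longest side is at least half of each other one, so
    that in [triangle_longest] the distances between sites can be replaced by
    distances to an arbitrary base point [x]. *)
Lemma triangle_bound x i j k a b e :
  near x (site i) -> near x (site j) -> near x (site k) ->
  0 <= a -> 0 <= b -> 0 <= e ->
  a * p i + b * p j + e * p k = 0 -> a * q i + b * q j + e * q k = 0 ->
  a * c i + b * c j + e * c k <=
    16 * (a * d x (site i) + b * d x (site j) + e * d x (site k)).
Proof.
move=> nxi nxj nxk a0 b0 e0 hp hq.
have nn y z : near x (site y) -> near x (site z) -> near (site y) (site z).
  by move=> xy xz; apply: (near_trans dM (near_sym dM xy) xz).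
have sq_le1 y : p y ^+ 2 + q y ^+ 2 <= 1.
  by rewrite (le_trans (sqr_le_l1 _ _)) // unit_normal expr1n.
have coef_le f y g z : 0 <= f -> 0 <= g ->
    f ^+ 2 * (p y ^+ 2 + q y ^+ 2) <= g ^+ 2 * (p z ^+ 2 + q z ^+ 2) -> f <= 2 * g.
  move=> f0 g0 h; rewrite -(@ler_pXn2r _ 2) ?nnegrE ?mulr_ge0 //.
  have := l1_unit_sqr_ge (unit_normal y); have := sq_le1 z.
  have := sqr_ge0 f; have := sqr_ge0 g; nra.
have tri y z : near x (site y) -> near x (site z) ->
    d (site y) (site z) <= d x (site y) + d x (site z).
  move=> xy xz; rewrite (lm_sym dM x (site y)).
  exact: (lm_triangle dM (near_sym dM xy) xz).
have main f y g z h w : near x (site y) -> near x (site z) -> near x (site w) ->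
    0 <= f -> 0 <= g -> 0 <= h ->
    f * p y + g * p z + h * p w = 0 -> f * q y + g * q z + h * q w = 0 ->
    f ^+ 2 * (p y ^+ 2 + q y ^+ 2) <= h ^+ 2 * (p w ^+ 2 + q w ^+ 2) ->
    g ^+ 2 * (p z ^+ 2 + q z ^+ 2) <= h ^+ 2 * (p w ^+ 2 + q w ^+ 2) ->
    f * c y + g * c z + h * c w <=
      16 * (f * d x (site y) + g * d x (site z) + h * d x (site w)).
  move=> xy xz xw f0 g0 h0 rp rq fh gh.
  have := triangle_longest (nn _ _ xy xw) (nn _ _ xz xw) f0 g0 h0 rp rq fh gh.
  have f2 := coef_le _ _ _ _ f0 h0 fh; have g2 := coef_le _ _ _ _ g0 h0 gh.
  have := ler_wpM2l f0 (tri _ _ xy xw); have := ler_wpM2l g0 (tri _ _ xz xw).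
  have := ler_wpM2r (lm_ge0 dM x (site w)) f2.
  have := ler_wpM2r (lm_ge0 dM x (site w)) g2.
  have := mulr_ge0 f0 (lm_ge0 dM x (site y)).
  have := mulr_ge0 g0 (lm_ge0 dM x (site z)).
  have := mulr_ge0 h0 (lm_ge0 dM x (site w)).
  lra.
set A := a ^+ 2 * (p i ^+ 2 + q i ^+ 2).
set B := b ^+ 2 * (p j ^+ 2 + q j ^+ 2).
set E := e ^+ 2 * (p k ^+ 2 + q k ^+ 2).
have [AE|/ltW EA] := leP A E.
  have [BE|/ltW EB] := leP B E; first exact: main.
  have := @main a i e k b j nxi nxk nxj a0 e0 b0 ltac:(lra) ltac:(lra) (le_trans AE EB) EB.
  lra.
have [BA|/ltW AB] := leP B A.
  have := @main b j e k a i nxj nxk nxi b0 e0 a0 ltac:(lra) ltac:(lra) BA EA.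
  lra.
have := @main a i e k b j nxi nxk nxj a0 e0 b0 ltac:(lra) ltac:(lra) AB (le_trans EA AB).
lra.
Qed.

(** Here three normals are left.  The one that stands alone on its side has the
    coefficient [|u|], so that moving its base point costs [|u| d x y]. *)
Lemma degenerate_quad_bound x y i j k l a1 a2 a3 a4 :
  near x y -> near x (site i) -> near x (site j) -> near y (site k) -> near y (site l) ->
  0 <= a1 -> 0 <= a2 -> 0 <= a3 -> 0 <= a4 ->
  a1 * p i + a2 * p j + a3 * p k + a4 * p l = 0 ->
  a1 * q i + a2 * q j + a3 * q k + a4 * q l = 0 ->
  a1 * a2 * a3 * a4 = 0 ->
  a1 * c i + a2 * c j + a3 * c k + a4 * c l <=
    16 * (a1 * d x (site i) + a2 * d x (site j) + a3 * d y (site k) + a4 * d y (site l)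
          + (`|a1 * p i + a2 * p j| + `|a1 * q i + a2 * q j|) * d x y).
Proof.
move=> nxy nxi nxj nyk nyl a10 a20 a30 a40 hp hq.
have nyx := near_sym dM nxy.
have nxk := near_trans dM nxy nyk; have nxl := near_trans dM nxy nyl.
have nyi := near_trans dM nyx nxi; have nyj := near_trans dM nyx nxj.
have l1_scale a z : 0 <= a -> `|a * p z| + `|a * q z| = a.
  by move=> a0; rewrite !normrM -mulrDr unit_normal mulr1 ger0_norm.
have txk := ler_wpM2l a30 (lm_triangle dM nxy nyk).
have txl := ler_wpM2l a40 (lm_triangle dM nxy nyl).
have tyi := ler_wpM2l a10 (lm_triangle dM nyx nxi).
have tyj := ler_wpM2l a20 (lm_triangle dM nyx nxj).
rewrite (lm_sym dM y x) in tyi tyj.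
move=> /eqP; rewrite !mulf_eq0 -!orbA => /or4P[]/eqP e0.
- have := triangle_bound nyj nyk nyl a20 a30 a40; rewrite e0 !mul0r !add0r in hp hq *.
  move=> /(_ hp hq); rewrite l1_scale //; lra.
- have := triangle_bound nyi nyk nyl a10 a30 a40; rewrite e0 !mul0r !addr0 in hp hq *.
  move=> /(_ hp hq); rewrite l1_scale //; lra.
- have -> : a1 * p i + a2 * p j = - (a4 * p l) by rewrite e0 in hp; lra.
  have -> : a1 * q i + a2 * q j = - (a4 * q l) by rewrite e0 in hq; lra.
  have := triangle_bound nxi nxj nxl a10 a20 a40; rewrite e0 !mul0r !addr0 in hp hq *.
  move=> /(_ hp hq); rewrite !normrN l1_scale //; lra.
- have -> : a1 * p i + a2 * p j = - (a3 * p k) by rewrite e0 in hp; lra.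
  have -> : a1 * q i + a2 * q j = - (a3 * q k) by rewrite e0 in hq; lra.
  have := triangle_bound nxi nxj nxk a10 a20 a30; rewrite e0 !mul0r !addr0 in hp hq *.
  move=> /(_ hp hq); rewrite !normrN l1_scale //; lra.
Qed.

Lemma cross_le1 i j : `|cross i j| <= 1.
Proof.
rewrite (le_trans (ler_normB _ _)) // !normrM.
have := unit_normal i; have := unit_normal j.
have := normr_ge0 (p i); have := normr_ge0 (p j).
have := normr_ge0 (q i); have := normr_ge0 (q j); nra.
Qed.

Lemma l1_le_double (u1 u2 v1 v2 : R) : u1 ^+ 2 + u2 ^+ 2 <= v1 ^+ 2 + v2 ^+ 2 ->
  `|u1| + `|u2| <= 2 * (`|v1| + `|v2|).
Proof.
move=> h; rewrite -(@ler_pXn2r _ 2) ?nnegrE ?mulr_ge0 ?addr_ge0 //.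
have := l1_sqr_le u1 u2; have := sqr_le_l1 v1 v2.
have := sqr_ge0 (`|v1| + `|v2|); rewrite exprMn; lra.
Qed.

(** If the normal [n_z] is a combination [(al u - be v) / dl] of two vectors of
    which [u] is the longer, then [dl] is at most [(al + be) |u|], up to the
    comparison of norms.  With [dl] the ratio of [u x v] to [n_i x n_j], this bounds
    the distance from [v] to the line through [u] without any angle. *)
Lemma cut_coef_le z (dl al be u1 u2 v1 v2 : R) : 0 <= al -> 0 <= be ->
  dl * p z = al * u1 - be * v1 -> dl * q z = al * u2 - be * v2 ->
  v1 ^+ 2 + v2 ^+ 2 <= u1 ^+ 2 + u2 ^+ 2 ->
  dl ^+ 2 <= 2 * (al + be) ^+ 2 * (u1 ^+ 2 + u2 ^+ 2).
Proof.
move=> al0 be0 hp hq vu.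
have h : dl ^+ 2 * (p z ^+ 2 + q z ^+ 2) <= (al + be) ^+ 2 * (u1 ^+ 2 + u2 ^+ 2).
  have -> : dl ^+ 2 * (p z ^+ 2 + q z ^+ 2) = (dl * p z) ^+ 2 + (dl * q z) ^+ 2 by ring.
  rewrite hp hq.
  have ab := mulr_ge0 al0 be0.
  have dot : - (u1 * v1 + u2 * v2) <= u1 ^+ 2 + u2 ^+ 2.
    by have := sqr_ge0 (u1 + v1); have := sqr_ge0 (u2 + v2); nra.
  have h1 := ler_wpM2l ab dot; have h2 := ler_wpM2l (sqr_ge0 be) vu.
  have -> : (al * u1 - be * v1) ^+ 2 + (al * u2 - be * v2) ^+ 2 =
    al ^+ 2 * (u1 ^+ 2 + u2 ^+ 2) + 2 * (al * be * - (u1 * v1 + u2 * v2)) +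
    be ^+ 2 * (v1 ^+ 2 + v2 ^+ 2) by ring.
  have -> : (al + be) ^+ 2 * (u1 ^+ 2 + u2 ^+ 2) =
    al ^+ 2 * (u1 ^+ 2 + u2 ^+ 2) + 2 * (al * be * (u1 ^+ 2 + u2 ^+ 2)) +
    be ^+ 2 * (u1 ^+ 2 + u2 ^+ 2) by ring.
  lra.
have := ler_wpM2l (sqr_ge0 dl) (l1_unit_sqr_ge (unit_normal z)).
lra.
Qed.

(** The vectors [u] and [v] are cut out of [u + v] by relations between three
    normals.  If the angle between them is at most right, neither is longer than
    [u + v] and the triangle bounds suffice.  If it is obtuse, write
    [u + v = (1 - h) u + w] with [w] orthogonal to [u]: the triangle bound serves
    for [(1 - h) u], which is no longer than [u + v], and the wedge bound for [w],
    which by [cut_coef_le] is short enough to absorb the inverse sines. *)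
Lemma quad_bound_of_cut x y i j k l b1 b2 b3 b4 e1 e2 e3 e4 :
  let u1 := b1 * p i + b2 * p j in let u2 := b1 * q i + b2 * q j in
  let v1 := e1 * p i + e2 * p j in let v2 := e1 * q i + e2 * q j in
  near x y -> near x (site i) -> near x (site j) -> near y (site k) -> near y (site l) ->
  cross i j != 0 -> cross k l != 0 ->
  0 <= b1 -> 0 <= b2 -> 0 <= b3 -> 0 <= b4 ->
  0 <= e1 -> 0 <= e2 -> 0 <= e3 -> 0 <= e4 ->
  u1 + b3 * p k + b4 * p l = 0 -> u2 + b3 * q k + b4 * q l = 0 ->
  v1 + e3 * p k + e4 * p l = 0 -> v2 + e3 * q k + e4 * q l = 0 ->
  b1 * b2 * b3 * b4 = 0 -> e1 * e2 * e3 * e4 = 0 ->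
  v1 ^+ 2 + v2 ^+ 2 <= u1 ^+ 2 + u2 ^+ 2 ->
  (b1 + e1) * c i + (b2 + e2) * c j + (b3 + e3) * c k + (b4 + e4) * c l <=
    64 * ((b1 + e1) * d x (site i) + (b2 + e2) * d x (site j) +
          (b3 + e3) * d y (site k) + (b4 + e4) * d y (site l)
          + (`|u1 + v1| + `|u2 + v2|) * d x y).
Proof.
move=> u1 u2 v1 v2 nxy nxi nxj nyk nyl X0 Y0 b10 b20 b30 b40 e10 e20 e30 e40.
move=> up uq vp vq bz ez vu.
have Vb := degenerate_quad_bound nxy nxi nxj nyk nyl b10 b20 b30 b40 up uq bz.
have Ve := degenerate_quad_bound nxy nxi nxj nyk nyl e10 e20 e30 e40 vp vq ez.
rewrite -/u1 -/u2 in Vb; rewrite -/v1 -/v2 in Ve.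
set dxi := d x (site i) in Vb Ve *; set dxj := d x (site j) in Vb Ve *.
set dyk := d y (site k) in Vb Ve *; set dyl := d y (site l) in Vb Ve *.
set D := d x y in Vb Ve *.
have dxi0 : 0 <= dxi by exact: lm_ge0 dM _ _.
have dxj0 : 0 <= dxj by exact: lm_ge0 dM _ _.
have dyk0 : 0 <= dyk by exact: lm_ge0 dM _ _.
have dyl0 : 0 <= dyl by exact: lm_ge0 dM _ _.
have D0 : 0 <= D by exact: lm_ge0 dM _ _.
set E := `|u1 + v1| + `|u2 + v2|.
have E0 : 0 <= E by rewrite addr_ge0.
have ED0 : 0 <= E * D by rewrite mulr_ge0.
have Pb1 := mulr_ge0 b10 dxi0; have Pb2 := mulr_ge0 b20 dxj0.
have Pb3 := mulr_ge0 b30 dyk0; have Pb4 := mulr_ge0 b40 dyl0.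
have Pe1 := mulr_ge0 e10 dxi0; have Pe2 := mulr_ge0 e20 dxj0.
have Pe3 := mulr_ge0 e30 dyk0; have Pe4 := mulr_ge0 e40 dyl0.
set S := u1 ^+ 2 + u2 ^+ 2 in vu *.
set T := u1 * v1 + u2 * v2.
have S0 : 0 <= S by rewrite addr_ge0 ?sqr_ge0.
(* Without cancellation in u + v, both pieces are no longer than their sum. *)
have [easy|/norP[Sn0 Tn]] := boolP ((S == 0) || (0 <= T)).
  have [uE vE] : u1 ^+ 2 + u2 ^+ 2 <= (u1 + v1) ^+ 2 + (u2 + v2) ^+ 2 /\
                 v1 ^+ 2 + v2 ^+ 2 <= (u1 + v1) ^+ 2 + (u2 + v2) ^+ 2.
    have -> : (u1 + v1) ^+ 2 + (u2 + v2) ^+ 2 = S + (v1 ^+ 2 + v2 ^+ 2) + 2 * T.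
      by rewrite /S /T; ring.
    have v0 : 0 <= v1 ^+ 2 + v2 ^+ 2 by rewrite addr_ge0 ?sqr_ge0.
    case/orP: easy => [/eqP S00|T0]; last by rewrite -/S; split; lra.
    have T0 : T = 0.
      move: S00 vu; rewrite /S => S00 vu.
      have/eqP := S00; rewrite paddr_eq0 ?sqr_ge0 // !sqrf_eq0 => /andP[/eqP uz1 /eqP uz2].
      by rewrite /T uz1 uz2 !mul0r addr0.
    by rewrite -/S; split; lra.
  have := ler_wpM2r D0 (l1_le_double uE); have := ler_wpM2r D0 (l1_le_double vE).
  rewrite -/E; lra.
have Sp : 0 < S by rewrite lt_def Sn0.
have T0 : T < 0 by rewrite ltNge.
pose h := - T / S.
have hS : h * S = - T by rewrite /h divfK.
have h0 : 0 <= h by rewrite divr_ge0 ?oppr_ge0 ?ltW.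
have h1 : h <= 1.
  rewrite ler_pdivrMr // mul1r.
  have := sqr_ge0 (u1 + v1); have := sqr_ge0 (u2 + v2); move: vu; rewrite /S /T; nra.
pose w1 := h * u1 + v1; pose w2 := h * u2 + v2.
have wS : (w1 ^+ 2 + w2 ^+ 2) * S = (u1 * v2 - u2 * v1) ^+ 2.
  have -> : (w1 ^+ 2 + w2 ^+ 2) * S =
     (h * S) ^+ 2 + 2 * (h * S) * T + (v1 ^+ 2 + v2 ^+ 2) * S.
    by rewrite /w1 /w2 /T /S; ring.
  by rewrite hS /T /S; ring.
have pyth : (u1 + v1) ^+ 2 + (u2 + v2) ^+ 2 =
    (1 - h) ^+ 2 * S + (w1 ^+ 2 + w2 ^+ 2).
  have -> : (u1 + v1) ^+ 2 + (u2 + v2) ^+ 2 = (1 - h) ^+ 2 * S + (w1 ^+ 2 + w2 ^+ 2) +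
    2 * (1 - h) * (h * S + T) by rewrite /w1 /w2 /S /T; ring.
  by rewrite hS; ring.
have w_le (X dl al be : R) z : 0 <= al -> 0 <= be ->
    dl * p z = al * u1 - be * v1 -> dl * q z = al * u2 - be * v2 ->
    u1 * v2 - u2 * v1 = dl * X -> `|w1| + `|w2| <= 2 * (al + be) * `|X|.
  move=> al0 be0 hp hq hX.
  have hdl := cut_coef_le al0 be0 hp hq vu.
  rewrite -(@ler_pXn2r _ 2) ?nnegrE ?mulr_ge0 ?addr_ge0 //.
  apply: le_trans (l1_sqr_le _ _) _.
  rewrite -(ler_pM2r Sp) -[2 * _ * S]mulrA wS hX.
  rewrite !exprMn real_normK ?num_real //.
  have := ler_wpM2r (sqr_ge0 X) hdl; rewrite -/S; lra.
set W := `|w1| + `|w2|.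
have W0 : 0 <= W by rewrite addr_ge0.
have wi : W <= 2 * (e2 + b2) * `|cross i j|.
  apply: (@w_le _ (b1 * e2 - b2 * e1) e2 b2 i) => //; rewrite /normal_cross /u1 /u2 /v1 /v2; ring.
have wj : W <= 2 * (b1 + e1) * `|cross i j|.
  rewrite [b1 + _]addrC -normrN.
  apply: (@w_le _ (b2 * e1 - b1 * e2) e1 b1 j) => //; rewrite /normal_cross /u1 /u2 /v1 /v2; ring.
have eu1 : u1 = - (b3 * p k + b4 * p l) by lra.
have eu2 : u2 = - (b3 * q k + b4 * q l) by lra.
have ev1 : v1 = - (e3 * p k + e4 * p l) by lra.
have ev2 : v2 = - (e3 * q k + e4 * q l) by lra.
have wk : W <= 2 * (e4 + b4) * `|cross k l|.
  rewrite -normrN.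
  apply: (@w_le _ (b4 * e3 - b3 * e4) e4 b4 k) => //; rewrite /normal_cross ?eu1 ?eu2 ?ev1 ?ev2; ring.
have wl : W <= 2 * (e3 + b3) * `|cross k l|.
  apply: (@w_le _ (b3 * e4 - b4 * e3) e3 b3 l) => //; rewrite /normal_cross ?eu1 ?eu2 ?ev1 ?ev2; ring.
have WE : W <= 2 * E.
  by apply: l1_le_double; rewrite pyth lerDr mulr_ge0 ?sqr_ge0.
have uE : (1 - h) * (`|u1| + `|u2|) <= 2 * E.
  rewrite mulrDr -{1 2}[1 - h]ger0_norm ?subr_ge0 // -!normrM.
  apply: l1_le_double; rewrite pyth !exprMn -mulrDr -/S lerDl.
  by rewrite addr_ge0 ?sqr_ge0.
have he (t t' : R) : 0 <= t -> 0 <= t' -> 0 <= h * t + t'.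
  by move=> t0 t'0; apply: addr_ge0 => //; apply: mulr_ge0.
have := wedge_bound (near_trans dM (near_sym dM nxi) nxj)
  (near_trans dM (near_sym dM nxi) (near_trans dM nxy nyk))
  (near_trans dM (near_sym dM nyk) nyl) X0 Y0
  (he _ _ b10 e10) (he _ _ b20 e20) (he _ _ b30 e30) (he _ _ b40 e40).
have -> : (h * b1 + e1) * p i + (h * b2 + e2) * p j = w1 by rewrite /w1 /u1 /v1; ring.
have -> : (h * b1 + e1) * q i + (h * b2 + e2) * q j = w2 by rewrite /w2 /u2 /v2; ring.
have -> : w1 + (h * b3 + e3) * p k + (h * b4 + e4) * p l = 0.
  by rewrite /w1 eu1 ev1; ring.
have -> : w2 + (h * b3 + e3) * q k + (h * b4 + e4) * q l = 0.
  by rewrite /w2 eu2 ev2; ring.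
move=> /(_ erefl erefl); rewrite -/W => Vw.
have dij : d (site i) (site j) <= dxi + dxj.
  by rewrite /dxi (lm_sym dM x); apply: (lm_triangle dM (near_sym dM nxi) nxj).
have dkl : d (site k) (site l) <= dyk + dyl.
  by rewrite /dyk (lm_sym dM y); apply: (lm_triangle dM (near_sym dM nyk) nyl).
have dik : d (site i) (site k) <= dxi + (D + dyk).
  have := lm_triangle dM nxy nyk.
  have := lm_triangle dM (near_sym dM nxi) (near_trans dM nxy nyk).
  rewrite (lm_sym dM (site i) x) -/dxi -/D -/dyk; lra.
have side_term (a a' X t f f' : R) : X != 0 -> 0 <= f -> 0 <= f' -> t <= f + f' ->
    W <= 2 * a * `|X| -> W <= 2 * a' * `|X| ->
    W * (2 * (t / `|X|)) <= 4 * (a * f + a' * f').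
  move=> Xn f0 f'0 tf.
  have Xp : 0 < `|X| by rewrite normr_gt0.
  move=> Wa Wa'; rewrite -ler_pdivrMr // in Wa; rewrite -ler_pdivrMr // in Wa'.
  have WX0 : 0 <= W / `|X| by rewrite divr_ge0.
  have := ler_wpM2l WX0 tf; have := ler_wpM2r f0 Wa; have := ler_wpM2r f'0 Wa'.
  have -> : W * (2 * (t / `|X|)) = 2 * (W / `|X| * t) by ring.
  lra.
have ti := side_term _ _ _ _ _ _ X0 dxi0 dxj0 dij wj wi.
have tk := side_term _ _ _ _ _ _ Y0 dyk0 dyl0 dkl wl wk.
have W1 : W <= 2 * (b1 + e1).
  by apply: le_trans wj _; rewrite ler_piMr ?cross_le1 ?mulr_ge0 ?addr_ge0.
have W3 : W <= 2 * (e3 + b3).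
  by apply: le_trans wl _; rewrite ler_piMr ?cross_le1 ?mulr_ge0 ?addr_ge0.
have td := ler_wpM2l W0 dik.
have t1 := ler_wpM2r dxi0 W1; have t3 := ler_wpM2r dyk0 W3; have tD := ler_wpM2r D0 WE.
have h1' : 0 <= 1 - h by rewrite subr_ge0.
have Vb' := ler_wpM2l h1' Vb.
have tu := ler_wpM2r D0 uE.
have hb1 := mulr_ge0 h0 Pb1; have hb2 := mulr_ge0 h0 Pb2.
have hb3 := mulr_ge0 h0 Pb3; have hb4 := mulr_ge0 h0 Pb4.
move: Vw; rewrite !mulrDr; move: ti tk td t1 t3 tD Vb' tu hb1 hb2 hb3 hb4.
move: Pb1 Pb2 Pb3 Pb4 Pe1 Pe2 Pe3 Pe4 ED0.
clear; lra.
Qed.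

(** What a selection of constant one implies, up to the factor [64], when its
    values at the sites are compared with its values at [x] and [y]. *)
Lemma quad_bound x y i j k l a1 a2 a3 a4 :
  near x y -> near x (site i) -> near x (site j) -> near y (site k) -> near y (site l) ->
  a2 = 0 \/ cross i j != 0 -> a4 = 0 \/ cross k l != 0 ->
  0 <= a1 -> 0 <= a2 -> 0 <= a3 -> 0 <= a4 ->
  a1 * p i + a2 * p j + a3 * p k + a4 * p l = 0 ->
  a1 * q i + a2 * q j + a3 * q k + a4 * q l = 0 ->
  a1 * c i + a2 * c j + a3 * c k + a4 * c l <=
    64 * (a1 * d x (site i) + a2 * d x (site j) + a3 * d y (site k) + a4 * d y (site l)
          + (`|a1 * p i + a2 * p j| + `|a1 * q i + a2 * q j|) * d x y).
Proof.
move=> nxy nxi nxj nyk nyl ij kl a10 a20 a30 a40 hp hq.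
have degenerate : a1 * a2 * a3 * a4 = 0 -> a1 * c i + a2 * c j + a3 * c k + a4 * c l <=
    64 * (a1 * d x (site i) + a2 * d x (site j) + a3 * d y (site k) + a4 * d y (site l)
          + (`|a1 * p i + a2 * p j| + `|a1 * q i + a2 * q j|) * d x y).
  move=> z; apply: le_trans (degenerate_quad_bound nxy nxi nxj nyk nyl a10 a20 a30 a40 hp hq z) _.
  by rewrite ler_wpM2r // ?ler_nat // !addr_ge0 ?mulr_ge0 ?addr_ge0 ?(lm_ge0 dM).
case: ij => [a2z|X0]; first by apply: degenerate; rewrite a2z mulr0 !mul0r.
case: kl => [a4z|Y0]; first by apply: degenerate; rewrite a4z mulr0.
have [b1 [b2 [b3 [b4 [[/andP[b10 ba1] /andP[b20 ba2] /andP[b30 ba3] /andP[b40 ba4]] bp bq bz ez]]]]] :=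
  split_relation a10 a20 a30 a40 hp hq X0.
have cut := @quad_bound_of_cut x y i j k l.
rewrite -subr_ge0 in ba1; rewrite -subr_ge0 in ba2.
rewrite -subr_ge0 in ba3; rewrite -subr_ge0 in ba4.
have ep : (a1 - b1) * p i + (a2 - b2) * p j + (a3 - b3) * p k + (a4 - b4) * p l = 0.
  by rewrite -[RHS](subrr 0) -{1}hp -bp; ring.
have eq : (a1 - b1) * q i + (a2 - b2) * q j + (a3 - b3) * q k + (a4 - b4) * q l = 0.
  by rewrite -[RHS](subrr 0) -{1}hq -bq; ring.
have add_cut (u v : R) : u + (v - u) = v by ring.
have cut_add (u v : R) : v - u + u = v by ring.
have sum_cut (u u' v v' f g : R) : u * f + u' * g + ((v - u) * f + (v' - u') * g) = v * f + v' * g by ring.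
have cut_sum (u u' v v' f g : R) : (v - u) * f + (v' - u') * g + (u * f + u' * g) = v * f + v' * g by ring.
have [le|/ltW le] := leP (((a1 - b1) * p i + (a2 - b2) * p j) ^+ 2 + ((a1 - b1) * q i + (a2 - b2) * q j) ^+ 2)
   ((b1 * p i + b2 * p j) ^+ 2 + (b1 * q i + b2 * q j) ^+ 2).
  have := cut b1 b2 b3 b4 _ _ _ _ nxy nxi nxj nyk nyl X0 Y0 b10 b20 b30 b40 ba1 ba2 ba3 ba4 bp bq ep eq bz ez le.
  by rewrite !add_cut !sum_cut.
have := cut _ _ _ _ b1 b2 b3 b4 nxy nxi nxj nyk nyl X0 Y0 ba1 ba2 ba3 ba4 b10 b20 b30 b40 ep eq bp bq ez bz le.
by rewrite !cut_add !cut_sum.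
Qed.

End Certificates.

(** * Moving a point of the rectangular hull into the set *)

Section Corners.
Variables (R : realType) (J : Type) (P : J -> Prop) (p q e : J -> R).

(** A quadrant is given by two booleans, [true] standing for the sign [+]. *)
Definition sgb (b : bool) : R := if b then 1 else -1.

Hypothesis unit_normal : forall j, `|p j| + `|q j| = 1.
(** With [e j] the violation of the inequality [j] at a given point, this says
    that the point satisfies all consequences of two inequalities that involve
    one coordinate only, that is, that it lies in the rectangular hull. *)
Hypothesis axis_comb_le0 : forall i j a b, P i -> P j -> 0 <= a -> 0 <= b ->
  (a * p i + b * p j) * (a * q i + b * q j) = 0 -> a * e i + b * e j <= 0.

(** The element [0] makes the set nonempty and the supremum nonnegative. *)
Definition corner (s t : bool) : R :=
  sup [set w | w = 0 \/ exists j, [/\ P j, 0 <= sgb s * p j, 0 <= sgb t * q j & w = e j]].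

Lemma sgb_norm s (x : R) : 0 <= sgb s * x -> sgb s * x = `|x|.
Proof. by move=> /ger0_norm <-; rewrite normrM /sgb; case: s; rewrite ?normrN normr1 mul1r. Qed.

(** Eliminate the first coordinate between [i] and [j]. *)
Lemma opposite_p i j : P i -> P j -> p i * p j <= 0 -> `|p j| * e i + `|p i| * e j <= 0.
Proof.
move=> Pi Pj pp; apply: axis_comb_le0 => //.
suff -> : `|p j| * p i + `|p i| * p j = 0 by rewrite mul0r.
have [pi0|pi0] := leP 0 (p i); have [pj0|pj0] := leP 0 (p j);
  rewrite ?(ger0_norm pi0) ?(ger0_norm pj0) ?(ltr0_norm pi0) ?(ltr0_norm pj0); nra.
Qed.

Lemma opposite_q i j : P i -> P j -> q i * q j <= 0 -> `|q j| * e i + `|q i| * e j <= 0.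
Proof.
move=> Pi Pj qq; apply: axis_comb_le0 => //.
suff -> : `|q j| * q i + `|q i| * q j = 0 by rewrite mulr0.
have [pi0|pi0] := leP 0 (q i); have [pj0|pj0] := leP 0 (q j);
  rewrite ?(ger0_norm pi0) ?(ger0_norm pj0) ?(ltr0_norm pi0) ?(ltr0_norm pj0); nra.
Qed.

Lemma pos_normal_neq0 i : P i -> 0 < e i -> p i != 0 /\ q i != 0.
Proof.
move=> Pi ei; apply/andP; rewrite -negb_or -mulf_eq0; apply/eqP => z.
have := @axis_comb_le0 i i 1 0 Pi Pi ler01 (lexx 0).
by rewrite !mul1r !mul0r !addr0 => /(_ z); rewrite leNgt ei.
Qed.

Lemma pos_same_quadrant i j : P i -> P j -> 0 < e i -> 0 < e j ->
  0 < p i * p j /\ 0 < q i * q j.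
Proof.
move=> Pi Pj ei ej.
have [pi0 qi0] := pos_normal_neq0 Pi ei; have [pj0 qj0] := pos_normal_neq0 Pj ej.
split; rewrite ltNge; apply/negP => h.
  have := opposite_p Pi Pj h; apply/negP; rewrite -ltNge.
  by rewrite addr_gt0 ?mulr_gt0 ?normr_gt0.
have := opposite_q Pi Pj h; apply/negP; rewrite -ltNge.
by rewrite addr_gt0 ?mulr_gt0 ?normr_gt0.
Qed.

(** Minus the l1 distance from the normal [j] to the quadrant. *)
Definition outside (s t : bool) j : R :=
  Num.min (sgb s * p j) 0 + Num.min (sgb t * q j) 0.

Lemma outside_le s t j : outside s t j <= sgb s * p j + sgb t * q j.
Proof. by rewrite /outside lerD // ge_min lexx. Qed.

Lemma outside_lt0 s t j : ~~ ((0 <= sgb s * p j) && (0 <= sgb t * q j)) -> outside s t j < 0.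
Proof.
rewrite negb_and -!ltNge => /orP[] h; rewrite /outside.
  by rewrite (min_idPl (ltW h)) ltr_wnDr // ge_min lexx orbT.
by rewrite (min_idPl (ltW h)) ltr_wnDl // ge_min lexx orbT.
Qed.

Lemma sgb_mul s (x y : R) : (sgb s * x) * (sgb s * y) = x * y.
Proof. by rewrite /sgb; case: s; ring. Qed.

Lemma norm_sgb s (x : R) : `|sgb s * x| = `|x|.
Proof. by rewrite normrM /sgb; case: s; rewrite ?normrN normr1 mul1r. Qed.

(** An inequality [i] violated at the base point leaves slack in those of the
    other quadrants, by elimination of a coordinate in which the two normals
    have opposite signs; the slack grows with the violation [e i]. *)
Lemma corner_dominates s t i j : P i -> P j -> 0 <= sgb s * p i -> 0 <= sgb t * q i ->
  0 < e i -> ~~ ((0 <= sgb s * p j) && (0 <= sgb t * q j)) ->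
  e j <= outside s t j * e i.
Proof.
move=> Pi Pj si ti ei out.
have [pi0 qi0] := pos_normal_neq0 Pi ei.
have ui := unit_normal i; have uj := unit_normal j.
have op := opposite_p Pi Pj; have oq := opposite_q Pi Pj.
rewrite -(sgb_mul s) in op; rewrite -(sgb_mul t) in oq.
rewrite -(norm_sgb s (p i)) -(norm_sgb s (p j)) in op ui uj.
rewrite -(norm_sgb t (q i)) -(norm_sgb t (q j)) in oq ui uj.
have pi0' : 0 < sgb s * p i.
  by rewrite lt_def si andbT -normr_gt0 norm_sgb normr_gt0.
have qi0' : 0 < sgb t * q i.
  by rewrite lt_def ti andbT -normr_gt0 norm_sgb normr_gt0.
move: out; rewrite negb_and -!ltNge /outside.
move: (sgb s * p i) (sgb s * p j) (sgb t * q i) (sgb t * q j) (e i) (e j) si ti ei ui uj op oq pi0' qi0'.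
move=> a b a' b' f g a0 a'0 f0 ui uj op oq ap a'p.
rewrite !(gtr0_norm ap) !(gtr0_norm a'p) in ui uj op oq.
have [b0|b0] := leP 0 b; have [b'0|b'0] := leP 0 b' => // _.
- rewrite add0r ger0_norm // in uj *.
  have : `|b'| * f + a' * g <= 0 by apply: oq; nra.
  rewrite ltr0_norm // => h; rewrite ltr0_norm // in uj.
  have [g0|g0] := leP g 0; last by nra.
  have : a' * g >= g by nra.
  nra.
- rewrite addr0 ltr0_norm // in uj *.
  have : `|b| * f + a * g <= 0 by apply: op; nra.
  rewrite ltr0_norm // => h.
  have [g0|g0] := leP g 0; last by nra.
  have : a * g >= g by nra.
  nra.
- have h1 : `|b'| * f + a' * g <= 0 by apply: oq; nra.
  have h2 : `|b| * f + a * g <= 0 by apply: op; nra.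
  rewrite !ltr0_norm // in h1 h2 uj.
  have -> : b + b' = -1 by lra.
  have -> : g = (a + a') * g by rewrite ui mul1r.
  have : (- b - b') * f = f by rewrite -[RHS]mul1r -uj.
  nra.
Qed.

Hypothesis normal_neg : exists2 j, P j & p j < 0.
Hypothesis normal_pos : exists2 j, P j & 0 < p j.

Let corner_set s t := [set w | w = 0 \/ exists j, [/\ P j, 0 <= sgb s * p j, 0 <= sgb t * q j & w = e j]].

Lemma corner_has_ubound s t : has_ubound (corner_set s t).
Proof.
have [j Pj sj] : exists2 j, P j & sgb s * p j < 0.
  case: s normal_neg normal_pos => -[j Pj hj] [k Pk hk].
    by exists j; rewrite // mul1r.
  by exists k; rewrite // mulN1r oppr_lt0.
have out : ~~ ((0 <= sgb s * p j) && (0 <= sgb t * q j)) by rewrite negb_and -ltNge sj.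
have m0 := outside_lt0 out.
exists (`|e j| / - outside s t j) => w [->|[i [Pi si ti ->]]].
  by rewrite divr_ge0 // oppr_ge0 ltW.
have [ei|ei] := leP (e i) 0.
  by apply: le_trans ei _; rewrite divr_ge0 // oppr_ge0 ltW.
rewrite ler_pdivlMr ?oppr_gt0 //.
have := corner_dominates Pi Pj si ti ei out.
have := ler_norm (- e j); rewrite normrN; lra.
Qed.

Lemma corner_nonempty s t : corner_set s t !=set0.
Proof. by exists 0; left. Qed.

Lemma corner_ge0 s t : 0 <= corner s t.
Proof. by apply: (ub_le_sup (corner_has_ubound s t)); left. Qed.

Lemma corner_ge s t j : P j -> 0 <= sgb s * p j -> 0 <= sgb t * q j -> e j <= corner s t.
Proof.
move=> Pj sj tj; apply: (ub_le_sup (corner_has_ubound s t)).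
by right; exists j.
Qed.

Lemma corner_le s t w : 0 <= w ->
  (forall j, P j -> 0 <= sgb s * p j -> 0 <= sgb t * q j -> e j <= w) -> corner s t <= w.
Proof.
move=> w0 h; apply: (ge_sup (corner_nonempty s t)) => _ [->//|[j [Pj sj tj ->]]].
exact: h.
Qed.

Lemma corner_gt0 s t : 0 < corner s t ->
  exists j, [/\ P j, 0 <= sgb s * p j, 0 <= sgb t * q j & 0 < e j].
Proof.
move=> r0; apply: contrapT => h; move: r0; apply/negP; rewrite -leNgt.
apply: corner_le => // j Pj sj tj; rewrite leNgt; apply/negP => ej.
by apply: h; exists j.
Qed.

Lemma sgb_inj_pos s s' (x y : R) : 0 <= sgb s * x -> 0 <= sgb s' * y -> 0 < x * y -> s = s'.
Proof. by rewrite /sgb; case: s; case: s' => //; rewrite ?mul1r ?mulN1r; nra. Qed.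

(** Two violated inequalities whose normals are in distinct quadrants would
    have a consequence that involves one coordinate and is violated too. *)
Lemma corner_unique s t s' t' : 0 < corner s t -> 0 < corner s' t' -> s = s' /\ t = t'.
Proof.
move=> /corner_gt0[i [Pi si ti ei]] /corner_gt0[j [Pj sj tj ej]].
have [pp qq] := pos_same_quadrant Pi Pj ei ej.
by split; [apply: sgb_inj_pos si sj pp|apply: sgb_inj_pos ti tj qq].
Qed.

(** Moving by the corner in the direction of its quadrant repairs the
    inequalities of this quadrant by definition.  Those of the other quadrants
    lose at most the slack that [corner_dominates] guarantees, after passing
    to the supremum over the violated inequalities [i]. *)
Lemma corner_shift s t j : P j -> 0 < corner s t ->
  e j <= (sgb s * p j + sgb t * q j) * corner s t.
Proof.
move=> Pj r0.
have [/andP[sj tj]|out] := boolP ((0 <= sgb s * p j) && (0 <= sgb t * q j)).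
  by rewrite (sgb_norm sj) (sgb_norm tj) unit_normal mul1r; apply: corner_ge.
have m0 := outside_lt0 out.
apply: le_trans (ler_wpM2r (ltW r0) (outside_le s t j)).
rewrite mulrC -ler_ndivlMr //.
have [i [Pi si ti ei]] := corner_gt0 r0.
have ub k : P k -> 0 <= sgb s * p k -> 0 <= sgb t * q k -> 0 < e k -> e k <= e j / outside s t j.
  move=> Pk sk tk ek; rewrite ler_ndivlMr // mulrC.
  exact: corner_dominates.
apply: corner_le => [|k Pk sk tk]; first by rewrite (le_trans (ltW ei)) ?ub.
have [ek|ek] := leP (e k) 0; last exact: ub.
by rewrite (le_trans ek) // (le_trans (ltW ei)) ?ub.
Qed.

(** The four shifts can be added up because at most one of them is nonzero; the
    sum, unlike a choice of quadrant, is Lipschitz in the base point. *)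
Lemma corner_sum_ge j : P j ->
  e j <= p j * (corner true true + corner true false - corner false true - corner false false)
       + q j * (corner true true - corner true false + corner false true - corner false false).
Proof.
move=> Pj.
have zero s t s' t' : 0 < corner s t -> (s, t) != (s', t') -> corner s' t' = 0.
  move=> r0 ne; apply/eqP; move: (corner_ge0 s' t'); rewrite le_eqVlt => /orP[/eqP<-//|r'].
  by have [e1 e2] := corner_unique r0 r'; rewrite e1 e2 eqxx in ne.
have all0_or : (forall s t, corner s t = 0) \/ exists s t, 0 < corner s t.
  have [h|h] := pselect (exists s t, 0 < corner s t); [by right|left=> s t].
  apply/eqP; move: (corner_ge0 s t); rewrite le_eqVlt => /orP[/eqP<-//|r'].
  by case: h; exists s, t.
case: all0_or => [z|[s [t r0]]].
  have : e j <= corner (0 <= p j) (0 <= q j).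
    have own_sign (x : R) : 0 <= sgb (0 <= x) * x.
      by rewrite /sgb; case: ifP => [h|/negbT]; [rewrite mul1r|rewrite -ltNge mulN1r oppr_ge0 => /ltW].
    exact: corner_ge.
  by rewrite !z; lra.
have := corner_shift Pj r0.
have others s' t' : corner s' t' = if (s, t) == (s', t') then corner s t else 0.
  by case: eqVneq => [[<- <-]//|]; exact: zero.
rewrite (others true true) (others true false) (others false true) (others false false).
by move: (corner s t) => r; case: s {r0 others}; case: t => /=; lra.
Qed.

End Corners.

(** * The selection *)

Lemma unit_parallel (R : realFieldType) (p q p' q' : R) :
  `|p| + `|q| = 1 -> `|p'| + `|q'| = 1 -> p * q' - q * p' = 0 ->
  (p' = p /\ q' = q) \/ (p' = - p /\ q' = - q).
Proof.
move=> u u' x.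
have e : p * q' = q * p' by lra.
have en : `|p| * `|q'| = `|q| * `|p'| by rewrite -!normrM e.
have ep : `|p'| = `|p| by nra.
have eq : `|q'| = `|q| by lra.
move/eqP: ep; rewrite eqr_norm2 => /orP[]/eqP ep; move/eqP: eq; rewrite eqr_norm2 => /orP[]/eqP eq;
  subst p' q'; [by left| | |by right].
- have /eqP : p * q = 0 by lra.
  rewrite mulf_eq0 => /orP[]/eqP z; subst; [right|left]; rewrite ?oppr0 //.
- have /eqP : p * q = 0 by lra.
  rewrite mulf_eq0 => /orP[]/eqP z; subst; [left|right]; rewrite ?oppr0 //.
Qed.

Section Selection.
Variables (R : realType) (M J : Type) (near : M -> M -> Prop) (d : M -> M -> R).
Variables (site : J -> M) (p q c : J -> R) (K : R).
Hypothesis dM : local_metric near d.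
Hypothesis unit_normal : forall j, `|p j| + `|q j| = 1.
Hypothesis K_ge0 : 0 <= K.
Local Notation cross := (normal_cross p q).

(** As seen from [x], the half-plane [j] is thickened by [K] times the distance
    to its site. *)
Definition offset x j := c j - K * d x (site j).

(** A consequence [u X + v Y >= w] of the thickened half-planes seen from [x].
    Parallel boundaries are excluded because the wedge bound says nothing about
    them. *)
Definition comb x u v w := exists i j a b,
  [/\ near x (site i), near x (site j), 0 <= a, 0 <= b & b = 0 \/ cross i j != 0] /\
  [/\ a * p i + b * p j = u, a * q i + b * q j = v & a * offset x i + b * offset x j = w].

Hypothesis opposite_offsets : forall x i j, near x (site i) -> near x (site j) ->
  p j = - p i -> q j = - q i -> offset x i + offset x j <= 0.
Hypothesis opposite_combs : forall x y u v w w', near x y ->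
  comb x u v w -> comb y (- u) (- v) w' -> w + w' <= K * (`|u| + `|v|) * d x y.
Hypothesis axis_combs : forall x u v, `|u| + `|v| = 1 -> u * v = 0 -> exists w, comb x u v w.

Lemma comb_scale x u v w t : 0 <= t -> comb x u v w -> comb x (t * u) (t * v) (t * w).
Proof.
move=> t0 [i [j [a [b [[ni nj a0 b0 ij] [<- <- <-]]]]]].
exists i, j, (t * a), (t * b); split; split; rewrite ?mulr_ge0 //; try ring.
by case: ij => [->|?]; [left; rewrite mulr0|right].
Qed.

Let minorants u v x := [set z | exists y w, [/\ near x y, comb y u v w & z = w - K * d x y]].

(** McShane's formula for the value of the form [(u, v)] on the selection. *)
Definition axis_selection u v x := sup (minorants u v x).

Section Axis.
Variables u v : R.
Hypotheses (uv1 : `|u| + `|v| = 1) (uv0 : u * v = 0).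

Lemma axis_selection_ub x w' : comb x (- u) (- v) w' -> ubound (minorants u v x) (- w').
Proof.
move=> cx z [y [w [nxy cy ->]]].
have := opposite_combs (near_sym dM nxy) cy cx.
by rewrite uv1 mulr1 (lm_sym dM y x); lra.
Qed.

Lemma axis_selection_has_ubound x : has_ubound (minorants u v x).
Proof.
have [w' cw] : exists w, comb x (- u) (- v) w.
  by apply: axis_combs; rewrite ?mulrNN // !normrN.
by exists (- w'); exact: axis_selection_ub.
Qed.

Lemma axis_selection_ge x w : comb x u v w -> w <= axis_selection u v x.
Proof.
move=> cw; apply: (ub_le_sup (axis_selection_has_ubound x)).
by exists x, w; split; rewrite ?(lm_refl dM) ?mulr0 ?subr0 //; exact: near_refl dM x.
Qed.

Lemma axis_selection_nonempty x : minorants u v x !=set0.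
Proof.
have [w cw] := axis_combs x uv1 uv0.
by exists (w - K * d x x), x, w; split => //; exact: near_refl dM x.
Qed.

Lemma axis_selection_le x w : comb x (- u) (- v) w -> w <= - axis_selection u v x.
Proof.
move=> cw; rewrite lerNr; apply: (ge_sup (axis_selection_nonempty x)).
exact: axis_selection_ub.
Qed.

Lemma axis_selection_lip x y : near x y -> axis_selection u v x <= axis_selection u v y + K * d x y.
Proof.
move=> nxy; apply: (ge_sup (axis_selection_nonempty x)) => _ [z [w [nxz cz ->]]].
have nyz := near_trans dM (near_sym dM nxy) nxz.
have : w - K * d y z <= axis_selection u v y.
  by apply: (ub_le_sup (axis_selection_has_ubound y)); exists z, w.
have := ler_wpM2l K_ge0 (lm_triangle dM (near_sym dM nxy) nxz).
rewrite (lm_sym dM y x); lra.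
Qed.

Lemma comb_le_axis_selection x t w : comb x (t * u) (t * v) w -> (t = 0 -> w <= 0) ->
  w <= t * axis_selection u v x.
Proof.
move=> cw w0; have [t0|t0|t0] := ltrgt0P t; last by rewrite t0 mul0r w0.
- have ti : 0 <= t^-1 by rewrite invr_ge0 ltW.
  have := comb_scale ti cw.
  rewrite !mulrA mulVf ?lt0r_neq0 // !mul1r => /axis_selection_ge.
  by rewrite ler_pdivrMl // mulrC.
- have t0' : 0 < - t by rewrite oppr_gt0.
  have ti : 0 <= (- t)^-1 by rewrite invr_ge0 ltW.
  have := comb_scale ti cw.
  have e : (- t)^-1 * t = -1 by field; rewrite lt_eqF.
  rewrite !mulrA e !mulN1r => /axis_selection_le.
  by rewrite ler_pdivrMl // mulrNN.
Qed.

End Axis.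

Let g1 := axis_selection 1 0.
Let g2 := axis_selection 0 1.

Let unit10 : `|1 : R| + `|0 : R| = 1. Proof. by rewrite normr1 normr0 addr0. Qed.
Let unit01 : `|0 : R| + `|1 : R| = 1. Proof. by rewrite normr1 normr0 add0r. Qed.

(** The violation of the inequality [j] at the point [(g1 x, g2 x)]. *)
Definition excess x j := offset x j - p j * g1 x - q j * g2 x.

(** [(g1 x, g2 x)] lies in the rectangular hull.  Pairs of parallel lines reduce
    to a single line, by [opposite_offsets] if the normals are opposite. *)
Lemma excess_comb_le0 x i j a b : near x (site i) -> near x (site j) ->
  0 <= a -> 0 <= b -> (a * p i + b * p j) * (a * q i + b * q j) = 0 ->
  a * excess x i + b * excess x j <= 0.
Proof.
(* Combinations allowed in [comb]: scale the axis vector to length one. *)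
have indep k l s t : near x (site k) -> near x (site l) -> 0 <= s -> 0 <= t ->
    t = 0 \/ cross k l != 0 -> (s * p k + t * p l) * (s * q k + t * q l) = 0 ->
    s * excess x k + t * excess x l <= 0.
  move=> nk nl s0 t0 kl z.
  pose u := s * p k + t * p l; pose v := s * q k + t * q l.
  have cw : comb x u v (s * offset x k + t * offset x l).
    by exists k, l, s, t.
  suff : s * offset x k + t * offset x l <= u * g1 x + v * g2 x.
    by rewrite /excess /u /v; lra.
  have w0 : u = 0 -> v = 0 -> s * offset x k + t * offset x l <= 0.
    rewrite /u /v => hu hv.
    suff [-> ->] : s = 0 /\ t = 0 by rewrite !mul0r addr0.
    case: kl => [t00|X0].
      move: hu hv; rewrite t00 !mul0r !addr0 => /eqP; rewrite mulf_eq0 => /orP[/eqP//|/eqP pk] /eqP.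
      rewrite mulf_eq0 => /orP[/eqP//|/eqP qk].
      by have := unit_normal k; rewrite pk qk normr0 addr0 => /eqP; rewrite eq_sym oner_eq0.
    split; apply: (mulIf X0); rewrite mul0r /normal_cross.
      have -> : s * (p k * q l - q k * p l) = (s * p k + t * p l) * q l - (s * q k + t * q l) * p l by ring.
      by rewrite hu hv !mul0r subrr.
    have -> : t * (p k * q l - q k * p l) = (s * q k + t * q l) * p k - (s * p k + t * p l) * q k by ring.
    by rewrite hu hv !mul0r subrr.
  move/eqP: z; rewrite -/u -/v mulf_eq0 => /orP[]/eqP z.
    rewrite z mul0r add0r; apply: (comb_le_axis_selection unit01 (mul0r 1)).
      by rewrite mulr0 mulr1 -z.
    by move=> v0; apply: w0.
  rewrite z mul0r addr0; apply: (comb_le_axis_selection unit10 (mulr0 1)).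
    by rewrite mulr0 mulr1 -z.
  by move=> u0; apply: w0.
move=> ni nj a0 b0 z.
have [X0|X0] := eqVneq (cross i j) 0; last by apply: indep => //; right.
have single k : near x (site k) -> p k * q k = 0 -> excess x k <= 0.
  move=> nk pq; have := indep k k 1 0 nk nk ler01 (lexx 0) (or_introl erefl).
  by rewrite !mul1r !mul0r !addr0; apply.
case: (unit_parallel (unit_normal i) (unit_normal j) X0) => [[pj qj]|[pj qj]].
  move: z; rewrite pj qj -!mulrDl.
  have -> : (a + b) * p i * ((a + b) * q i) = (a + b) ^+ 2 * (p i * q i) by ring.
  move=> /eqP; rewrite mulf_eq0 sqrf_eq0 paddr_eq0 // => /orP[/andP[/eqP-> /eqP->]|/eqP pq].
    by rewrite !mul0r addr0.
  have := ler_wpM2l a0 (single i ni pq).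
  have := ler_wpM2l b0 (single j nj _); rewrite pj qj pq !mulr0 => /(_ erefl); lra.
have opp : excess x i + excess x j <= 0.
  by have := opposite_offsets ni nj pj qj; rewrite /excess pj qj; lra.
move: z; rewrite pj qj.
have -> : (a * p i + b * - p i) * (a * q i + b * - q i) = (a - b) ^+ 2 * (p i * q i) by ring.
move=> /eqP; rewrite mulf_eq0 sqrf_eq0 subr_eq0 => /orP[/eqP<-|/eqP pq].
  by rewrite -mulrDr; have := ler_wpM2l a0 opp; rewrite mulr0.
have := ler_wpM2l a0 (single i ni pq).
have := ler_wpM2l b0 (single j nj _); rewrite pj qj mulrNN pq !mulr0 => /(_ erefl); lra.
Qed.

Let corner_at s t x := corner (fun j => near x (site j)) p q (excess x) s t.

Lemma axis_member x (u : R) : `|u| = 1 ->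
  exists2 j, near x (site j) & 0 < u * p j.
Proof.
move=> u1.
have [w [i [j [a [b [[ni nj a0 b0 _] [hp _ _]]]]]]] :
    exists w, comb x u 0 w by apply: axis_combs; rewrite ?normr0 ?addr0 ?mulr0.
have uu : 0 < u * u by rewrite -expr2 -(real_normK (num_real u)) u1 expr1n.
have [h|h] := ltP 0 (u * p i); first by exists i.
exists j => //; rewrite ltNge; apply/negP => h'.
have := mulr_ge0_le0 a0 h; have := mulr_ge0_le0 b0 h'.
move: uu; rewrite -{2}hp; lra.
Qed.

Let normal_neg x : exists2 j, near x (site j) & p j < 0.
Proof.
have [|j nj h] := @axis_member x (-1); first by rewrite normrN normr1.
by exists j => //; move: h; rewrite mulN1r oppr_gt0.
Qed.

Let normal_pos x : exists2 j, near x (site j) & 0 < p j.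
Proof.
have [|j nj h] := @axis_member x 1; first by rewrite normr1.
by exists j => //; move: h; rewrite mul1r.
Qed.

Let corner_hyps x := @excess_comb_le0 x.

Lemma excess_lip x y j : near x y -> near x (site j) -> excess x j <= excess y j + 2 * K * d x y.
Proof.
move=> nxy nxj.
have nyx := near_sym dM nxy.
have l1 : `|g1 y - g1 x| <= K * d x y.
  have := @axis_selection_lip 1 0 unit10 (mulr0 1) x y nxy.
  have := @axis_selection_lip 1 0 unit10 (mulr0 1) y x nyx.
  by rewrite (lm_sym dM y x) -/g1 ler_norml; lra.
have l2 : `|g2 y - g2 x| <= K * d x y.
  have := @axis_selection_lip 0 1 unit01 (mul0r 1) x y nxy.
  have := @axis_selection_lip 0 1 unit01 (mul0r 1) y x nyx.
  by rewrite (lm_sym dM y x) -/g2 ler_norml; lra.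
have off : offset x j <= offset y j + K * d x y.
  have nyj := near_trans dM nyx nxj.
  have := ler_wpM2l K_ge0 (lm_triangle dM nyx nxj).
  by rewrite /offset (lm_sym dM y x); lra.
have h1 := ler_wpM2l (normr_ge0 (p j)) l1; have h2 := ler_wpM2l (normr_ge0 (q j)) l2.
have := ler_norm (p j * (g1 y - g1 x)); have := ler_norm (q j * (g2 y - g2 x)).
rewrite !normrM => h3 h4.
have : `|p j| * (K * d x y) + `|q j| * (K * d x y) = K * d x y.
  by rewrite -mulrDl unit_normal mul1r.
rewrite /excess; lra.
Qed.

Lemma corner_at_lip s t x y : near x y -> corner_at s t x <= corner_at s t y + 2 * K * d x y.
Proof.
move=> nxy; have nyx := near_sym dM nxy.
apply: corner_le => [|j nj sj tj].
  by rewrite addr_ge0 ?mulr_ge0 ?(lm_ge0 dM) //; apply: (corner_ge0 unit_normal (@corner_hyps y) (normal_neg y) (normal_pos y)).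
apply: le_trans (excess_lip nxy nj) _; rewrite lerD2r.
apply: (corner_ge unit_normal (@corner_hyps y) (normal_neg y) (normal_pos y)) => //.
exact: (near_trans dM nyx nj).
Qed.

(** The constant counts [K] for [g1] or [g2] and [2 K] for each of the four
    corners. *)
Theorem lipschitz_selection_of_combs : exists f1 f2 : M -> R,
  (forall j, c j <= p j * f1 (site j) + q j * f2 (site j)) /\
  (forall x y, near x y -> `|f1 x - f1 y| <= 9 * K * d x y /\ `|f2 x - f2 y| <= 9 * K * d x y).
Proof.
exists (fun x => g1 x + (corner_at true true x + corner_at true false x
                         - corner_at false true x - corner_at false false x)).
exists (fun x => g2 x + (corner_at true true x - corner_at true false x
                         + corner_at false true x - corner_at false false x)).
split=> [j|x y nxy].
  have nj := near_refl dM (site j).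
  have := corner_sum_ge unit_normal (@corner_hyps (site j)) (normal_neg _) (normal_pos _) nj.
  rewrite /excess /offset (lm_refl dM) mulr0 subr0 -/(corner_at _ _ _).
  rewrite /corner_at; lra.
have nyx := near_sym dM nxy.
have sy := lm_sym dM y x.
have := @axis_selection_lip 1 0 unit10 (mulr0 1) x y nxy.
have := @axis_selection_lip 1 0 unit10 (mulr0 1) y x nyx.
have := @axis_selection_lip 0 1 unit01 (mul0r 1) x y nxy.
have := @axis_selection_lip 0 1 unit01 (mul0r 1) y x nyx.
have := corner_at_lip true true nxy; have := corner_at_lip true true nyx.
have := corner_at_lip true false nxy; have := corner_at_lip true false nyx.
have := corner_at_lip false true nxy; have := corner_at_lip false true nyx.
have := corner_at_lip false false nxy; have := corner_at_lip false false nyx.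
rewrite sy -/g1 -/g2 !ler_norml; move: (d x y) => D.
by move=> *; split; apply/andP; split; lra.
Qed.

End Selection.

(** * Half-planes of the plane in coordinates *)

Section PlaneCoordinates.
Variable R : realType.
Implicit Types (z w : 'rV[R]_2) (H : halfplane R).

Definition xc z : R := z ord0 ord0.
Definition yc z : R := z ord0 ord_max.
Definition vec (a b : R) : 'rV[R]_2 := \row_j (if j == ord0 then a else b).

Lemma xc_vec a b : xc (vec a b) = a. Proof. by rewrite /xc mxE eqxx. Qed.
Lemma yc_vec a b : yc (vec a b) = b. Proof. by rewrite /yc mxE. Qed.

Lemma xcB z w : xc (z - w) = xc z - xc w. Proof. by rewrite /xc !mxE. Qed.
Lemma ycB z w : yc (z - w) = yc z - yc w. Proof. by rewrite /yc !mxE. Qed.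

Lemma dotE z w : dot z w = xc z * xc w + yc z * yc w.
Proof.
rewrite /dot !big_ord_recl big_ord0 addr0.
by congr (_ + _ * _); rewrite /yc; congr (_ ord0 _); apply: val_inj.
Qed.

Lemma norm_le z l : (`|z| <= l) = (`|xc z| <= l) && (`|yc z| <= l).
Proof.
apply/idP/andP => [zl|[xl yl]].
  have cl i : `|z ord0 i| <= l.
    apply: le_trans zl; rewrite [leRHS]/Num.norm /= mx_normrE.
    by apply/bigmax_geP; right; exists (ord0, i).
  by rewrite /xc /yc !cl.
have l0 : 0 <= l by apply: le_trans xl.
rewrite [leLHS]/Num.norm /= mx_normrE; apply/bigmax_leP; split=> // -[i j] _ /=.
rewrite (ord1 i); case: j => -[|[|//]] lt2.
  by move: xl; rewrite /xc; congr (`|z _ _| <= _); apply: val_inj.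
by move: yl; rewrite /yc; congr (`|z _ _| <= _); apply: val_inj.
Qed.

Lemma xc_le_norm z : `|xc z| <= `|z|.
Proof. by have := lexx `|z|; rewrite norm_le => /andP[]. Qed.

Lemma yc_le_norm z : `|yc z| <= `|z|.
Proof. by have := lexx `|z|; rewrite norm_le => /andP[]. Qed.

Lemma eq_vec z w : xc z = xc w -> yc z = yc w -> z = w.
Proof.
move=> ex ey; apply/eqP; rewrite -subr_eq0 -normr_le0 norm_le xcB ycB ex ey.
by rewrite !subrr normr0 lexx.
Qed.

Lemma linear_form_le z a b : a * xc z + b * yc z <= (`|a| + `|b|) * `|z|.
Proof.
rewrite mulrDl lerD // (le_trans (ler_norm _)) // normrM ler_wpM2l //.
  exact: xc_le_norm.
exact: yc_le_norm.
Qed.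

Lemma sqr_norm_le z : xc z ^+ 2 + yc z ^+ 2 <= 2 * `|z| ^+ 2.
Proof.
have sq (a : R) : `|a| <= `|z| -> a ^+ 2 <= `|z| ^+ 2.
  by rewrite -[a ^+ 2]real_normK ?num_real // ler_pXn2r ?nnegrE.
by rewrite mulrDl mul1r lerD ?sq ?xc_le_norm ?yc_le_norm.
Qed.

Lemma enorm_ge0 z : 0 <= enorm z. Proof. exact: sqrtr_ge0. Qed.

Lemma sqr_enorm z : enorm z ^+ 2 = xc z ^+ 2 + yc z ^+ 2.
Proof. by rewrite sqr_sqrtr dotE -!expr2 ?addr_ge0 ?sqr_ge0. Qed.

Lemma enorm_le z : enorm z <= Num.sqrt 2 * `|z|.
Proof.
rewrite -(@ler_pXn2r _ 2) ?nnegrE ?mulr_ge0 ?enorm_ge0 ?sqrtr_ge0 //.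
by rewrite sqr_enorm exprMn sqr_sqrtr ?ler0n // sqr_norm_le.
Qed.

Lemma norm_le_enorm z : `|z| <= enorm z.
Proof.
have sq (a b : R) : `|a| <= Num.sqrt (a ^+ 2 + b ^+ 2).
  by rewrite -sqrtr_sqr ler_wsqrtr // lerDl sqr_ge0.
by rewrite norm_le /enorm dotE -!expr2 sq addrC sq.
Qed.

Lemma enorm_gt0 z : z != 0 -> 0 < enorm z.
Proof. by move=> z0; rewrite (lt_le_trans _ (norm_le_enorm z)) // normr_gt0. Qed.

Lemma enorm_le_l1 z : enorm z <= `|xc z| + `|yc z|.
Proof.
rewrite -(@ler_pXn2r _ 2) ?nnegrE ?addr_ge0 ?enorm_ge0 //.
by rewrite sqr_enorm; exact: sqr_le_l1.
Qed.

Definition det z w := xc z * yc w - yc z * xc w.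

Lemma sqr_det z w : det z w ^+ 2 + dot z w ^+ 2 = (enorm z * enorm w) ^+ 2.
Proof. by rewrite exprMn !sqr_enorm dotE /det; ring. Qed.

Lemma sin_line_angle z w : z != 0 -> w != 0 ->
  sin (line_angle z w) = `|det z w| / (enorm z * enorm w).
Proof.
move=> z0 w0; have zw0 : 0 < enorm z * enorm w by rewrite mulr_gt0 ?enorm_gt0.
have le1 : `|dot z w| / (enorm z * enorm w) <= 1.
  rewrite ler_pdivrMr // mul1r -(@ler_pXn2r _ 2) ?nnegrE ?(ltW zw0) //.
  by rewrite -sqr_det real_normK ?num_real // lerDr sqr_ge0.
rewrite /line_angle sin_acos; last first.
  by rewrite le1 andbT (le_trans (lerN10 R)) // divr_ge0 // ltW.
have -> : 1 - (`|dot z w| / (enorm z * enorm w)) ^+ 2 = (det z w / (enorm z * enorm w)) ^+ 2.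
  rewrite !expr_div_n real_normK ?num_real // -[1](divff (lt0r_neq0 (exprn_gt0 2 zw0))).
  by rewrite -mulrBl -sqr_det addrK.
by rewrite sqrtr_sqr normrM normfV (gtr0_norm zw0).
Qed.

Lemma hp_direction_coords H :
  xc (hp_direction H) = - yc (hp_normal H) /\ yc (hp_direction H) = xc (hp_normal H).
Proof. by rewrite /hp_direction /xc /yc !mxE. Qed.

Lemma sin_hp_angle H H' : sin (hp_angle H H') =
  `|det (hp_normal H) (hp_normal H')| / (enorm (hp_normal H) * enorm (hp_normal H')).
Proof.
have [x1 y1] := hp_direction_coords H; have [x2 y2] := hp_direction_coords H'.
have dir0 (K : halfplane R) : hp_direction K != 0.
  apply: contra_neq (hp_normal_neq0 K) => dK; have [x y] := hp_direction_coords K.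
  by apply: eq_vec; [rewrite -y|rewrite -[LHS]opprK -x]; rewrite dK /xc /yc !mxE ?oppr0.
have e (K : halfplane R) : enorm (hp_direction K) = enorm (hp_normal K).
  by have [x y] := hp_direction_coords K; rewrite /enorm !dotE x y mulrNN addrC.
rewrite sin_line_angle // !e; congr (`|_| / _).
by rewrite /det x1 y1 x2 y2; ring.
Qed.

(** The normal of a half-plane points outwards; [hp_p], [hp_q] and [hp_c] give
    its equation by the inner normal of l1 norm one, dual to the uniform norm. *)
Definition hp_l1 H : R := `|xc (hp_normal H)| + `|yc (hp_normal H)|.
Definition hp_p H : R := - xc (hp_normal H) / hp_l1 H.
Definition hp_q H : R := - yc (hp_normal H) / hp_l1 H.
Definition hp_c H : R := - hp_offset H / hp_l1 H.

Lemma hp_l1_gt0 H : 0 < hp_l1 H.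
Proof.
exact: lt_le_trans (enorm_gt0 (hp_normal_neq0 H)) (enorm_le_l1 _).
Qed.

Lemma hp_unit H : `|hp_p H| + `|hp_q H| = 1.
Proof.
rewrite /hp_p /hp_q !normrM !normrN normfV (gtr0_norm (hp_l1_gt0 H)) -mulrDl.
by rewrite divff // lt0r_neq0 // hp_l1_gt0.
Qed.

Lemma hp_setP H z : hp_set H z <-> hp_c H <= hp_p H * xc z + hp_q H * yc z.
Proof.
have l0 := hp_l1_gt0 H.
rewrite /hp_set /= dotE /hp_c /hp_p /hp_q.
have -> : - xc (hp_normal H) / hp_l1 H * xc z + - yc (hp_normal H) / hp_l1 H * yc z =
  - (xc (hp_normal H) * xc z + yc (hp_normal H) * yc z) / hp_l1 H by ring.
by rewrite ler_pM2r ?invr_gt0 // lerN2.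
Qed.

(** The sine is normalised by Euclidean norms, which are smaller than l1
    norms. *)
Lemma cross_le_sin H H' : `|hp_p H * hp_q H' - hp_q H * hp_p H'| <= sin (hp_angle H H').
Proof.
rewrite sin_hp_angle /hp_p /hp_q.
have l0 := hp_l1_gt0 H; have l0' := hp_l1_gt0 H'.
have -> : - xc (hp_normal H) / hp_l1 H * (- yc (hp_normal H') / hp_l1 H') -
  - yc (hp_normal H) / hp_l1 H * (- xc (hp_normal H') / hp_l1 H') =
  det (hp_normal H) (hp_normal H') / (hp_l1 H * hp_l1 H').
  by rewrite /det; field; rewrite !lt0r_neq0.
rewrite normrM normfV (gtr0_norm (mulr_gt0 l0 l0')) ler_wpM2l //.
rewrite lef_pV2 ?posrE ?mulr_gt0 ?enorm_gt0 ?hp_normal_neq0 //.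
by rewrite ler_pM ?enorm_ge0 ?enorm_le_l1.
Qed.

End PlaneCoordinates.

Section SetDist.
Variable R : realType.
Implicit Types A B : set 'rV[R]_2.

Lemma set_dist_ge A B m : A !=set0 -> B !=set0 ->
  (forall a b, A a -> B b -> m <= `|a - b|) -> m <= set_dist A B.
Proof.
move=> [a Aa] [b Bb] h; apply: lb_le_inf; first by exists `|a - b|, a => //; exists b.
by move=> _ [a' Aa' [b' Bb' <-]]; exact: h.
Qed.

Lemma set_dist_le A B a b : A a -> B b -> set_dist A B <= `|a - b|.
Proof.
move=> Aa Bb; apply: ge_inf; first by exists 0 => _ [a' _ [b' _ <-]].
by exists a => //; exists b.
Qed.

End SetDist.

Section ScaleInfty.
Variable R : realType.

Lemma scale_infty_le (l T : R) (s : \bar R) : 0 <= l -> (s <= T%:E)%E ->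
  (scale_infty l s <= (l * T)%:E)%E.
Proof.
move=> l0 sT; rewrite /scale_infty; case: eqP => [sy|_]; first by rewrite sy in sT.
by rewrite EFinM lee_wpmul2l // lee_fin.
Qed.

Lemma scale_infty_fin (l t : R) : scale_infty l t%:E = (l * t)%:E.
Proof. by []. Qed.

End ScaleInfty.

(** * Bounded intersections of half-planes *)

Section PositiveSpan.
Variables (R : realType) (J : Type) (P : J -> Prop) (eta xi : J -> R).

(** Vectors that no half-plane through the origin contains span every direction
    by nonnegative combinations of two of them.  The vectors of the upper and of
    the lower half-plane are compared by their slopes: if none of the pairs
    spans the first basis vector, then the supremum [k] of the upper slopes
    yields the vector [(-1, k)], which has a nonnegative product with all. *)
Lemma positive_span_e1 :
  (forall a b, (a != 0) || (b != 0) -> exists2 j, P j & eta j * a + xi j * b < 0) ->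
  exists i j a b, [/\ P i, P j, 0 <= a & 0 <= b] /\
    [/\ b = 0 \/ eta i * xi j - xi i * eta j != 0,
        a * eta i + b * eta j = 1 & a * xi i + b * xi j = 0].
Proof.
move=> norec; apply: contrapT => none.
have xi0 j : P j -> xi j = 0 -> eta j <= 0.
  move=> Pj x0; rewrite leNgt; apply/negP => e0; apply: none.
  exists j, j, (eta j)^-1, 0; split; first by split=> //; rewrite invr_ge0 ltW.
  split; [by left| |]; rewrite ?x0 !(mulr0, mul0r) addr0 //.
  by rewrite mulVf // lt0r_neq0.
have slopes i j : P i -> P j -> 0 < xi i -> xi j < 0 -> eta i / xi i <= eta j / xi j.
  move=> Pi Pj xip xjn; rewrite leNgt; apply/negP => lt; apply: none.
  have m0 : 0 < xi i * eta j - eta i * xi j.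
    have : eta j / xi j * (xi i * - xi j) < eta i / xi i * (xi i * - xi j).
      by rewrite ltr_pM2r // mulr_gt0 // oppr_gt0.
    have -> : eta j / xi j * (xi i * - xi j) = - (eta j * xi i) by field; rewrite lt_eqF.
    have -> : eta i / xi i * (xi i * - xi j) = - (eta i * xi j) by field; rewrite gt_eqF.
    lra.
  set m := xi i * eta j - eta i * xi j in m0.
  have mn := lt0r_neq0 m0.
  exists i, j, (- xi j / m), (xi i / m); split.
    by split=> //; rewrite divr_ge0 ?oppr_ge0 ?ltW.
  split; last by field.
    by right; rewrite -opprB oppr_eq0.
  by rewrite mulrAC [xi i / m * _]mulrAC -mulrDl mulNr [_ + _]addrC [xi j * _]mulrC divff.
have [[i0 Pi0 xi0p]|nopos] := pselect (exists2 i, P i & 0 < xi i); last first.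
  have [j Pj] : exists2 j, P j & eta j * 0 + xi j * -1 < 0.
    by apply: norec; rewrite oppr_eq0 oner_eq0 orbT.
  by rewrite mulr0 add0r mulrN1 oppr_lt0 => xj; apply: nopos; exists j.
have [[j0 Pj0 xj0n]|noneg] := pselect (exists2 j, P j & xi j < 0); last first.
  have [j Pj] : exists2 j, P j & eta j * 0 + xi j * 1 < 0.
    by apply: norec; rewrite oner_eq0 orbT.
  by rewrite mulr0 add0r mulr1 => xj; apply: noneg; exists j.
pose S := [set k | exists i, [/\ P i, 0 < xi i & k = eta i / xi i]].
have S0 : S !=set0 by exists (eta i0 / xi i0), i0.
have Sub : has_ubound S.
  by exists (eta j0 / xi j0) => _ [i [Pi xip ->]]; exact: slopes.
have [j Pj] : exists2 j, P j & eta j * -1 + xi j * sup S < 0.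
  by apply: norec; rewrite oppr_eq0 oner_eq0.
apply/negP; rewrite -leNgt mulrN1 addrC subr_ge0.
have [xjp|xjn|xj0] := ltrgt0P (xi j).
- have : eta j / xi j <= sup S by apply: (ub_le_sup Sub); exists j.
  by rewrite ler_pdivrMr // mulrC.
- have : sup S <= eta j / xi j.
    by apply: (ge_sup S0) => _ [i [Pi xip ->]]; exact: slopes.
  by rewrite ler_ndivlMr // mulrC.
- by rewrite xj0 mul0r; exact: xi0.
Qed.

End PositiveSpan.

Section Recession.
Variable R : realType.

(** A direction along which no half-plane is left would be the direction of a
    ray contained in the compact set. *)
Lemma no_recession (G : set 'rV[R]_2) (HG : set (halfplane R)) a b :
  G !=set0 -> compact G -> G = \bigcap_(H in HG) hp_set H ->
  (a != 0) || (b != 0) -> exists2 H, HG H & hp_p H * a + hp_q H * b < 0.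
Proof.
move=> [z0 Gz0] /compact_bounded[B [_ bG]] GE ab; apply: contrapT => none.
have ray t : 0 <= t -> G (vec (xc z0 + t * a) (yc z0 + t * b)).
  move=> t0; move: Gz0; rewrite GE => Gz0 H HGH.
  apply/hp_setP; rewrite xc_vec yc_vec; have /hp_setP := Gz0 H HGH.
  have : 0 <= hp_p H * a + hp_q H * b.
    by rewrite leNgt; apply/negP => lt; apply: none; exists H.
  by move=> /(mulr_ge0 t0); lra.
have bound t : 0 <= t -> `|xc z0 + t * a| <= B + 1 /\ `|yc z0 + t * b| <= B + 1.
  have B1 : B < B + 1 by rewrite ltrDl.
  by move=> t0; have := bG (B + 1) B1 _ (ray t t0); rewrite /= norm_le xc_vec yc_vec => /andP.
have contra (s e : R) : e != 0 -> (forall t, 0 <= t -> `|s + t * e| <= B + 1) -> False.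
  move=> e0 h; have ep : 0 < `|e| by rewrite normr_gt0.
  have B0 : 0 <= B + 1 by apply: le_trans (h 0 (lexx 0)).
  have t0 : 0 <= (B + 1 + `|s| + 1) / `|e| by apply: divr_ge0 => //; have := normr_ge0 s; lra.
  have := h _ t0; set t := _ / _ => ht.
  have te : `|t * e| = B + 1 + `|s| + 1 by rewrite normrM (ger0_norm t0) /t divfK ?gt_eqF.
  have : `|t * e| <= `|s + t * e| + `|s|.
    by have := ler_normB (s + t * e) s; rewrite addrC addKr.
  by rewrite te; lra.
case/orP: ab => e0.
  by apply: (contra (xc z0) a e0) => t /bound[].
by apply: (contra (yc z0) b e0) => t /bound[].
Qed.

End Recession.

(** * Sufficiency of the four half-planes condition *)

Section Sufficiency.
Variables (R : realType) (M : Type) (rho : M -> M -> \bar R).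
Variables (G : M -> set 'rV[R]_2) (HG : M -> set (halfplane R)) (l : R).
Hypothesis rhoM : is_pseudometric rho.
Hypothesis G_nonempty : forall x, G x !=set0.
Hypothesis G_compact : forall x, compact (G x).
Hypothesis GE : forall x, G x = \bigcap_(H in HG x) hp_set H.
Hypothesis l_ge0 : 0 <= l.
Hypothesis condition : halfplane_condition rho HG l.

Definition finitely_near x y : Prop := (rho x y < +oo)%E.
Notation near := finitely_near.
Definition real_rho x y : R := fine (rho x y).
Notation r := real_rho.

Lemma nearE x y : near x y -> rho x y = (r x y)%:E.
Proof. by move=> n; rewrite fineK // ge0_fin_numE // (pm_ge0 rhoM). Qed.

Lemma near_local_metric : local_metric near r.
Proof.
have tr x y z : near x z -> near z y -> near x y.
  move=> xz zy; apply: le_lt_trans (pm_triangle rhoM x y z) _.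
  by rewrite lte_add_pinfty.
split=> [x|x y|x y z|x y|x|x y|x y z].
- by rewrite /near (pm_refl rhoM).
- by rewrite /near (pm_sym rhoM).
- exact: tr.
- by rewrite fine_ge0 // (pm_ge0 rhoM).
- by rewrite /r (pm_refl rhoM).
- by rewrite /r (pm_sym rhoM).
- move=> xz zy; have xy := tr _ _ _ xz zy.
  by have := pm_triangle rhoM x y z; rewrite !nearE // -EFinD lee_fin.
Qed.

Let rM := near_local_metric.

Lemma diam_quad_le x x' y y' : near x x' -> near x y -> near y y' ->
  (diam rho [set z | [\/ z = x, z = x', z = y | z = y']] <= (r x x' + r x y + r y y')%:E)%E.
Proof.
move=> xx' xy yy'; apply: ge_ereal_sup => _ [a + [b + <-]].
have [nx'x nyx ny'y] := And3 (near_sym rM xx') (near_sym rM xy) (near_sym rM yy').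
have nxy' := near_trans rM xy yy'; have nx'y := near_trans rM nx'x xy.
have nx'y' := near_trans rM nx'x nxy'.
have [t1 t2 t3] := And3 (lm_triangle rM xy yy') (lm_triangle rM nx'x xy) (lm_triangle rM nx'y yy').
have [g1 g2 g3] := And3 (lm_ge0 rM x x') (lm_ge0 rM x y) (lm_ge0 rM y y').
have sx : r x' x = r x x' by exact: lm_sym rM _ _.
have le p q : near p q -> r p q <= r x x' + r x y + r y y' ->
    (rho p q <= (r x x' + r x y + r y y')%:E)%E /\ (rho q p <= (r x x' + r x y + r y y')%:E)%E.
  by move=> n h; rewrite (pm_sym rhoM q) !nearE // lee_fin.
have self p : (rho p p <= (r x x' + r x y + r y y')%:E)%E.
  by rewrite (pm_refl rhoM) lee_fin !addr_ge0.
have [l1 l1'] : (rho x x' <= _)%E /\ _ := le x x' xx' ltac:(lra).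
have [l2 l2'] : (rho x y <= _)%E /\ _ := le x y xy ltac:(lra).
have [l3 l3'] : (rho y y' <= _)%E /\ _ := le y y' yy' ltac:(lra).
have [l4 l4'] : (rho x y' <= _)%E /\ _ := le x y' nxy' ltac:(lra).
have [l5 l5'] : (rho x' y <= _)%E /\ _ := le x' y nx'y ltac:(lra).
have [l6 l6'] : (rho x' y' <= _)%E /\ _ := le x' y' nx'y' ltac:(lra).
by case=> [->|->|->|->]; case=> [->|->|->|->].
Qed.

Lemma condition_fin x x' y y' H1 H2 H3 H4 (t t' : R) :
  HG x H1 -> HG x' H2 -> HG y H3 -> HG y' H4 ->
  near x x' -> near x y -> near y y' ->
  (rho x x' / (sin (hp_angle H1 H2))%:E <= t%:E)%E ->
  (rho y y' / (sin (hp_angle H3 H4))%:E <= t'%:E)%E ->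
  set_dist (hp_set H1 `&` hp_set H2) (hp_set H3 `&` hp_set H4) <=
    l * (t + t' + (r x x' + r x y + r y y')).
Proof.
move=> h1 h2 h3 h4 xx' xy yy' ht ht'.
rewrite -lee_fin; apply: le_trans (condition h1 h2 h3 h4) _.
apply: scale_infty_le => //; rewrite !EFinD leeD ?leeD //.
by rewrite -!EFinD; exact: diam_quad_le.
Qed.

(** The half-planes of all the points, each remembering its point. *)
Definition constraint := {xH : M * halfplane R | HG xH.1 xH.2}.
Definition site (j : constraint) := (sval j).1.
Definition hp (j : constraint) := (sval j).2.
Notation p := (fun j => hp_p (hp j)).
Notation q := (fun j => hp_q (hp j)).
Notation c := (fun j => hp_c (hp j)).
Notation d := (fun x y => l * r x y).
Local Notation cross := (normal_cross p q).

Let hp_in j : HG (site j) (hp j) := svalP j.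

Lemma scaled_local_metric : local_metric near d.
Proof.
split; [exact: near_refl rM|exact: near_sym rM|exact: near_trans rM| | | |].
- by move=> x y; rewrite mulr_ge0 // (lm_ge0 rM).
- by move=> x; rewrite (lm_refl rM) mulr0.
- by move=> x y; rewrite (lm_sym rM).
- by move=> x y z xz zy; rewrite -mulrDr ler_wpM2l // (lm_triangle rM).
Qed.

Lemma hp_set_nonempty (H : halfplane R) : hp_set H !=set0.
Proof.
have [p0|p0] := eqVneq (hp_p H) 0.
  have q0 : hp_q H != 0.
    by apply: contra_eq_neq (hp_unit H) => ->; rewrite p0 normr0 addr0 eq_sym oner_eq0.
  exists (vec 0 (hp_c H / hp_q H)); apply/hp_setP.
  by rewrite xc_vec yc_vec mulr0 add0r mulrC divfK.
exists (vec (hp_c H / hp_p H) 0); apply/hp_setP.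
by rewrite xc_vec yc_vec mulr0 addr0 mulrC divfK.
Qed.

Lemma wedge_nonempty i j : cross i j != 0 -> hp_set (hp i) `&` hp_set (hp j) !=set0.
Proof.
move=> X0.
exists (vec ((c i * q j - q i * c j) / cross i j) ((p i * c j - c i * p j) / cross i j)).
split; apply/hp_setP; rewrite xc_vec yc_vec /normal_cross; move: X0; rewrite /normal_cross => X0;
  rewrite le_eqVlt; apply/orP; left; apply/eqP; field; exact: X0.
Qed.

(** The condition for [H1 = H2] and [H3 = H4]: the quotients are then [0 / 0]. *)
Lemma antiparallel_bound_of_condition i j : near (site i) (site j) ->
  p i = - p j -> q i = - q j -> c i + c j <= d (site i) (site j).
Proof.
move=> nij pp qq.
have zero H x : (rho x x / (sin (hp_angle H H))%:E <= 0%:E)%E.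
  by rewrite (pm_refl rhoM) mul0e.
have := condition_fin (hp_in i) (hp_in i) (hp_in j) (hp_in j) (near_refl rM _) nij
  (near_refl rM _) (zero _ _) (zero _ _).
rewrite !(lm_refl rM) !setIid !add0r addr0; apply: le_trans.
apply: set_dist_ge; [exact: hp_set_nonempty|exact: hp_set_nonempty|].
move=> a b /hp_setP ha /hp_setP hb.
have := linear_form_le (a - b) (p i) (q i); rewrite hp_unit mul1r xcB ycB.
by move: pp qq => /= pp qq; rewrite pp qq in ha *; lra.
Qed.

Lemma wedge_bound_of_condition i j k m (a1 a2 a3 a4 : R) :
  near (site i) (site j) -> near (site i) (site k) -> near (site k) (site m) ->
  cross i j != 0 -> cross k m != 0 ->
  0 <= a1 -> 0 <= a2 -> 0 <= a3 -> 0 <= a4 ->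
  a1 * p i + a2 * p j + a3 * p k + a4 * p m = 0 ->
  a1 * q i + a2 * q j + a3 * q k + a4 * q m = 0 ->
  a1 * c i + a2 * c j + a3 * c k + a4 * c m <=
    (`|a1 * p i + a2 * p j| + `|a1 * q i + a2 * q j|) *
    (2 * (d (site i) (site j) / `|cross i j|) +
     2 * (d (site k) (site m) / `|cross k m|) + d (site i) (site k)).
Proof.
move=> nij nik nkm X0 Y0 a10 a20 a30 a40 hpn hqn.
set u := a1 * p i + a2 * p j; set v := a1 * q i + a2 * q j.
set S := a1 * c i + a2 * c j + a3 * c k + a4 * c m.
have ang_le (s t : constraint) : near (site s) (site t) -> cross s t != 0 ->
    (rho (site s) (site t) / (sin (hp_angle (hp s) (hp t)))%:E <=
      (r (site s) (site t) / `|cross s t|)%:E)%E.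
  move=> n Z0; have Zp : 0 < `|cross s t| by rewrite normr_gt0.
  have le := cross_le_sin (hp s) (hp t).
  have sp := lt_le_trans Zp le.
  rewrite nearE // inver gt_eqF // -EFinM lee_fin ler_wpM2l ?(lm_ge0 rM) //.
  by rewrite lef_pV2 ?posrE.
have := condition_fin (hp_in i) (hp_in j) (hp_in k) (hp_in m) nij nik nkm
  (ang_le _ _ nij X0) (ang_le _ _ nkm Y0).
set D := set_dist _ _ => Dle.
have sep a b : hp_set (hp i) a /\ hp_set (hp j) a ->
    hp_set (hp k) b /\ hp_set (hp m) b -> S <= (`|u| + `|v|) * `|a - b|.
  move=> [/hp_setP ai /hp_setP aj] [/hp_setP bk /hp_setP bm].
  apply: le_trans (linear_form_le (a - b) u v); rewrite xcB ycB.
  have := ler_wpM2l a10 ai; have := ler_wpM2l a20 aj.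
  have := ler_wpM2l a30 bk; have := ler_wpM2l a40 bm.
  have eu : a3 * p k + a4 * p m = - u by move: hpn; rewrite /u /=; lra.
  have ev : a3 * q k + a4 * q m = - v by move: hqn; rewrite /v /=; lra.
  have : (a3 * p k + a4 * p m) * xc b + (a3 * q k + a4 * q m) * yc b = - u * xc b - v * yc b.
    by rewrite eu ev; ring.
  by rewrite /S /u /v; lra.
have [w wW] := wedge_nonempty X0; have [w' wW'] := wedge_nonempty Y0.
have SD : S <= (`|u| + `|v|) * D.
  have [n0|n0] := eqVneq (`|u| + `|v|) 0.
    by have := sep _ _ wW wW'; rewrite n0 !mul0r.
  have np : 0 < `|u| + `|v| by rewrite lt_def n0 addr_ge0.
  rewrite mulrC -ler_pdivrMr //; apply: set_dist_ge; [by exists w|by exists w'|].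
  by move=> a b aW bW; rewrite ler_pdivrMr // mulrC; exact: sep.
apply: le_trans SD _; rewrite ler_wpM2l ?addr_ge0 //; apply: le_trans Dle _.
have le_div s t : cross s t != 0 -> r (site s) (site t) <= r (site s) (site t) / `|cross s t|.
  move=> Z0; rewrite ler_pdivlMr ?normr_gt0 // ler_piMr ?(lm_ge0 rM) //.
  by apply: (cross_le1 (p := p) (q := q)) => z; exact: hp_unit.
have h1 := ler_wpM2l l_ge0 (le_div _ _ X0); have h2 := ler_wpM2l l_ge0 (le_div _ _ Y0).
lra.
Qed.

Let quad := quad_bound scaled_local_metric (fun j => hp_unit (hp j))
  antiparallel_bound_of_condition wedge_bound_of_condition.

Lemma opposite_offsets_le0 x i j : near x (site i) -> near x (site j) ->
  p j = - p i -> q j = - q i ->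
  offset d site c 64 x i + offset d site c 64 x j <= 0.
Proof.
move=> ni nj pp qq; rewrite /offset.
have nij := near_trans rM (near_sym rM ni) nj.
have := @antiparallel_bound_of_condition i j nij; rewrite pp qq !opprK => /(_ erefl erefl).
have := lm_triangle scaled_local_metric (near_sym rM ni) nj.
have := lm_ge0 scaled_local_metric x (site i).
have := lm_ge0 scaled_local_metric x (site j).
rewrite (lm_sym scaled_local_metric (site i) x); lra.
Qed.

Lemma opposite_combs_le x y u v w w' : near x y ->
  comb near d site p q c 64 x u v w -> comb near d site p q c 64 y (- u) (- v) w' ->
  w + w' <= 64 * (`|u| + `|v|) * d x y.
Proof.
move=> nxy [i [j [a1 [a2 [[ni nj a10 a20 ij] [hu hv <-]]]]]].
move=> [k [m [a3 [a4 [[nk nm a30 a40 km] [hu' hv' <-]]]]]].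
have := @quad x y i j k m a1 a2 a3 a4 nxy ni nj nk nm ij km a10 a20 a30 a40.
have -> : a1 * p i + a2 * p j + a3 * p k + a4 * p m = 0 by rewrite hu -addrA hu' subrr.
have -> : a1 * q i + a2 * q j + a3 * q k + a4 * q m = 0 by rewrite hv -addrA hv' subrr.
move=> /(_ erefl erefl); rewrite hu hv /offset; lra.
Qed.

(** The half-planes of the point [x] itself suffice.  The coordinates are
    turned so that [(u, v)] becomes the first basis vector. *)
Lemma axis_combs_exist x u v : `|u| + `|v| = 1 -> u * v = 0 ->
  exists w, comb near d site p q c 64 x u v w.
Proof.
move=> uv1 uv0.
have uv2 : u ^+ 2 + v ^+ 2 = 1.
  move/eqP: uv0 uv1; rewrite mulf_eq0 => /orP[]/eqP ->; rewrite normr0 ?add0r ?addr0 => e;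
    by rewrite expr0n /= ?add0r ?addr0 -real_normK ?num_real // e expr1n.
have [|i [j [a [b [[Pi Pj a0 b0] [ind e1 e2]]]]]] :=
  @positive_span_e1 R constraint (fun j => site j = x)
    (fun j => u * p j + v * q j) (fun j => u * q j - v * p j).
  move=> a b ab.
  have [|H HH lt] := @no_recession R (G x) (HG x) (u * a - v * b) (v * a + u * b)
     (G_nonempty x) (@G_compact x) (GE x).
    apply: contraT; rewrite negb_or !negbK => /andP[/eqP z1 /eqP z2].
    have a0 : a = u * (u * a - v * b) + v * (v * a + u * b).
      by rewrite -[LHS]mul1r -uv2; ring.
    have b0 : b = u * (v * a + u * b) - v * (u * a - v * b).
      by rewrite -[LHS]mul1r -uv2; ring.
    rewrite z1 z2 !mulr0 addr0 in a0; rewrite z1 z2 !mulr0 subr0 in b0.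
    by move: ab; rewrite a0 b0 eqxx.
  exists (exist _ (x, H) HH : constraint) => //; rewrite /hp /=; lra.
exists (a * offset d site c 64 x i + b * offset d site c 64 x j), i, j, a, b.
split; split=> //; rewrite ?Pi ?Pj ?/near ?(pm_refl rhoM) //.
- case: ind => [?|h]; [by left|right].
  move: h; rewrite /normal_cross; apply: contra_neq => z.
  rewrite -[RHS](mulr0 (u ^+ 2 + v ^+ 2)) -z; ring.
- have -> : a * p i + b * p j = (u ^+ 2 + v ^+ 2) * (a * p i + b * p j) by rewrite uv2 mul1r.
  transitivity (u * (a * (u * p i + v * q i) + b * (u * p j + v * q j)) -
    v * (a * (u * q i - v * p i) + b * (u * q j - v * p j))); first by ring.
  by rewrite e1 e2 mulr1 mulr0 subr0.
- have -> : a * q i + b * q j = (u ^+ 2 + v ^+ 2) * (a * q i + b * q j) by rewrite uv2 mul1r.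
  transitivity (v * (a * (u * p i + v * q i) + b * (u * p j + v * q j)) +
    u * (a * (u * q i - v * p i) + b * (u * q j - v * p j))); first by ring.
  by rewrite e1 e2 mulr1 mulr0 addr0.
Qed.

(** The constant is nine times the factor [64] of [quad_bound]. *)
Theorem selection_of_condition : exists2 f, selection G f & lip_bound rho f (576 * l).
Proof.
have [f1 [f2 [sel lip]]] := lipschitz_selection_of_combs scaled_local_metric
  (fun j => hp_unit (hp j)) (ler0n R 64) opposite_offsets_le0 opposite_combs_le axis_combs_exist.
exists (fun x => vec (f1 x) (f2 x)) => [x|].
  rewrite GE => H HH; apply/hp_setP; rewrite xc_vec yc_vec.
  exact: (sel (exist _ (x, H) HH : constraint)).
split=> [|x y]; first by rewrite mulr_ge0.
have [nxy|] := boolP (rho x y < +oo)%E; last first.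
  by rewrite -leNgt leye_eq => /eqP ->; rewrite /scale_infty eqxx leey.
rewrite nearE // scale_infty_fin lee_fin norm_le xcB ycB !xc_vec !yc_vec.
have [h1 h2] := lip x y nxy.
by apply/andP; split; lra.
Qed.

End Sufficiency.

(** * Necessity of the condition, and the theorem *)

Lemma finite_terms (R : realType) (A B D : \bar R) :
  (0 <= A)%E -> (0 <= B)%E -> (0 <= D)%E -> (A + B + D != +oo)%E ->
  exists a b e, [/\ A = a%:E, B = b%:E & D = e%:E].
Proof.
by case: A => [a| |] //; case: B => [b| |] //; case: D => [e| |] // _ _ _ _; exists a, b, e.
Qed.

Section Necessity.
Variables (R : realType) (M : Type) (rho : M -> M -> \bar R).
Variables (G : M -> set 'rV[R]_2) (HG : M -> set (halfplane R)) (l : R).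
Variable f : M -> 'rV[R]_2.
Hypothesis rhoM : is_pseudometric rho.
Hypothesis GE : forall x, G x = \bigcap_(H in HG x) hp_set H.
Hypothesis f_sel : selection G f.
Hypothesis f_lip : lip_bound rho f l.

Let l_ge0 : 0 <= l. Proof. by case: f_lip. Qed.

Lemma lip_fin x y t : (rho x y <= t%:E)%E -> `|f x - f y| <= l * t.
Proof.
by move=> le; rewrite -lee_fin (le_trans (f_lip.2 x y)) // scale_infty_le.
Qed.

Lemma selection_hp x H : HG x H -> hp_set H (f x).
Proof. by move=> HH; have := f_sel x; rewrite GE; exact. Qed.

Lemma div_sin_ge0 x y (H H' : halfplane R) : (0 <= rho x y / (sin (hp_angle H H'))%:E)%E.
Proof.
rewrite mule_ge0 ?(pm_ge0 rhoM) // inve_ge0 lee_fin sin_hp_angle.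
by rewrite divr_ge0 // mulr_ge0 ?enorm_ge0.
Qed.

(** The point is found on the parallel to the boundary of [H] through [f x].  If
    the boundaries of [H] and [H'] are parallel, a finite quotient means that
    [x] and [x'] are at distance zero, so that [f x = f x']. *)
Lemma wedge_near_selection x x' H H' t : HG x H -> HG x' H' ->
  (rho x x' / (sin (hp_angle H H'))%:E = t%:E)%E ->
  exists2 z, (hp_set H `&` hp_set H') z & `|f x - z| <= Num.sqrt 2 * l * t.
Proof.
move=> HH HH' et.
have t0 : 0 <= t by rewrite -lee_fin -et div_sin_ge0.
have fH := selection_hp HH; have fH' := selection_hp HH'.
have s0 : 0 <= Num.sqrt 2 * l * t by rewrite !mulr_ge0 ?sqrtr_ge0.
pose n := hp_normal H; pose n' := hp_normal H'.
have n0 := enorm_gt0 (hp_normal_neq0 H); have n'0 := enorm_gt0 (hp_normal_neq0 H').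
have sE := sin_hp_angle H H'; rewrite -/n -/n' in n0 n'0 sE.
have [D0|D0] := eqVneq (det n n') 0.
  (* Parallel boundaries: the quotient is infinite unless rho x x' = 0. *)
  move: et; rewrite sE D0 normr0 mul0r inve0.
  have [r0|r0] := eqVneq (rho x x') 0%E; last first.
    by rewrite gt0_muley // lt_def r0 (pm_ge0 rhoM).
  move=> _; have : `|f x - f x'| <= l * 0 by apply: lip_fin; rewrite r0.
  rewrite mulr0 normr_le0 subr_eq0 => /eqP e.
  by exists (f x); [split=> //; rewrite e|rewrite subrr normr0].
have sp : 0 < sin (hp_angle H H') by rewrite sE divr_gt0 ?normr_gt0 ?mulr_gt0.
have rt : rho x x' = (t * sin (hp_angle H H'))%:E.
  move: et; rewrite inver gt_eqF //; case: (rho x x') (pm_ge0 rhoM x x') => [r| |] //.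
    by rewrite -EFinM => _ [<-]; rewrite divfK // gt_eqF.
  by rewrite gt0_mulye ?lte_fin ?invr_gt0.
have lip : `|f x' - f x| <= l * (t * sin (hp_angle H H')).
  by rewrite distrC lip_fin // rt.
pose w := f x' - f x.
(* Slide f x along the boundary of H until n' takes the same value as at f x'. *)
pose tau := (xc n' * xc w + yc n' * yc w) / det n n'.
pose z := vec (xc (f x) - tau * yc n) (yc (f x) + tau * xc n).
have along : det n n' * tau = xc n' * xc w + yc n' * yc w by rewrite mulrC divfK.
exists z.
  split.
    move: fH; rewrite /hp_set /= !dotE -/n xc_vec yc_vec; apply: le_trans.
    by rewrite le_eqVlt; apply/orP; left; apply/eqP; ring.
  move: fH'; rewrite /hp_set /= !dotE -/n' xc_vec yc_vec; apply: le_trans.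
  rewrite le_eqVlt; apply/orP; left; apply/eqP.
  by move: along; rewrite /det /w xcB ycB; lra.
have ev : enorm (f x - z) = `|tau| * enorm n.
  rewrite /enorm !dotE xcB ycB xc_vec yc_vec -sqrtr_sqr -sqrtrM ?sqr_ge0 //.
  by congr Num.sqrt; ring.
apply: le_trans (norm_le_enorm _) _; rewrite ev.
have tau_le : `|tau| * `|det n n'| <= enorm n' * enorm w.
  rewrite -normrM mulrC along -dotE -(@ler_pXn2r _ 2) ?nnegrE ?mulr_ge0 ?enorm_ge0 //.
  by rewrite -sqr_det real_normK ?num_real // lerDr sqr_ge0.
have w_le : enorm w <= Num.sqrt 2 * (l * (t * sin (hp_angle H H'))).
  by apply: le_trans (enorm_le w) _; rewrite ler_wpM2l ?sqrtr_ge0.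
have D0' : 0 < `|det n n'| by rewrite normr_gt0.
rewrite -(ler_pM2r D0') mulrAC.
have -> : Num.sqrt 2 * l * t * `|det n n'| =
    enorm n' * (Num.sqrt 2 * (l * (t * sin (hp_angle H H')))) * enorm n.
  by rewrite sE; field; rewrite !lt0r_neq0.
rewrite ler_wpM2r ?enorm_ge0 //; apply: le_trans tau_le _.
by rewrite ler_wpM2l ?enorm_ge0.
Qed.

Lemma diam_ge (A : set M) x y : A x -> A y -> (rho x y <= diam rho A)%E.
Proof. by move=> Ax Ay; apply: ereal_sup_ubound; exists x => //; exists y. Qed.

Lemma condition_of_selection : halfplane_condition rho HG (Num.sqrt 2 * l).
Proof.
move=> x x' y y' H1 H2 H3 H4 h1 h2 h3 h4.
set A := (rho x x' / _)%E; set B := (rho y y' / _)%E; set D := diam _ _.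
have A0 : (0 <= A)%E by exact: div_sin_ge0.
have B0 : (0 <= B)%E by exact: div_sin_ge0.
have xyD : (rho x y <= D)%E by apply: diam_ge; [exact: Or41|exact: Or43].
have D0 : (0 <= D)%E := le_trans (pm_ge0 rhoM x y) xyD.
have [s|s] := eqVneq (A + B + D)%E +oo%E; first by rewrite s /scale_infty eqxx leey.
have [a [b [e [eA eB eD]]]] := finite_terms A0 B0 D0 s.
have e0 : (0 <= e%:E)%E by rewrite -eD.
rewrite eA eB eD -!EFinD scale_infty_fin lee_fin.
have [z zW zn] := wedge_near_selection h1 h2 eA.
have [z' zW' zn'] := wedge_near_selection h3 h4 eB.
apply: le_trans (set_dist_le zW zW') _.
have fxy : `|f x - f y| <= l * e by apply: lip_fin; rewrite -eD.
have s1 : l * e <= Num.sqrt 2 * l * e.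
  rewrite lee_fin in e0; rewrite -mulrA ler_peMl ?mulr_ge0 //.
  by rewrite -[leLHS]sqrtr1 ler_wsqrtr // ler1n.
have -> : z - z' = (f x - f y) - (f x - z) + (f y - z').
  by rewrite opprB [f x - f y + _]addrC !subrKA.
apply: le_trans (ler_normD _ _) _.
have := ler_normB (f x - f y) (f x - z); lra.
Qed.

End Necessity.

Theorem theorem1p8 (R : realType) :
  exists2 gamma : R, 0 < gamma &
  forall (M : Type) (rho : M -> M -> \bar R)
    (G : M -> set 'rV[R]_2) (HG : M -> set (halfplane R)),
    is_pseudometric rho ->
    (forall x, [/\ G x !=set0, convex_set (G x) & compact (G x)]) ->
    (forall x, G x = \bigcap_(H in HG x) hp_set H) ->
    ((exists f : M -> 'rV[R]_2, lip_selection rho G f) <->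
     (exists2 l : R, 0 <= l & halfplane_condition rho HG l)) /\
    let inf_l : \bar R :=
      ereal_inf [set l%:E | l in [set l : R | 0 <= l /\ halfplane_condition rho HG l]] in
    ((Num.sqrt 2)^-1%:E * inf_l <= selection_seminorm rho G)%E /\
    (selection_seminorm rho G <= gamma%:E * inf_l)%E.
Proof.
exists 576 => [|M rho G HG rhoM Gx GE]; first by rewrite ltr0n.
have G0 x : G x !=set0 by case: (Gx x).
have Gc x : compact (G x) by case: (Gx x).
have sel_of l : 0 <= l -> halfplane_condition rho HG l ->
    exists2 f, selection G f & lip_bound rho f (576 * l).
  exact: selection_of_condition.
have cond_of f l : selection G f -> lip_bound rho f l ->
    0 <= Num.sqrt 2 * l /\ halfplane_condition rho HG (Num.sqrt 2 * l).
  move=> sf lf; split; first by rewrite mulr_ge0 ?sqrtr_ge0 //; case: lf.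
  exact: (condition_of_selection rhoM GE sf lf).
have semi_le f l : lip_bound rho f l -> (lip_seminorm rho f <= l%:E)%E.
  by move=> lf; apply: ereal_inf_lbound; exists l.
split.
  split=> [[f [sf lf]]|[l l0 cl]].
    have [_ [l lb <-] _] := ereal_inf_lt lf.
    by have [s0 cs] := cond_of f l sf lb; exists (Num.sqrt 2 * l).
  have [f sf lf] := sel_of l l0 cl.
  by exists f; split=> //; apply: le_lt_trans (semi_le _ _ lf) (ltry _).
move=> inf_l; split.
  apply: le_ereal_inf_tmp => _ [f [sf _] <-].
  apply: le_ereal_inf_tmp => _ [l lb <-].
  have s2 : (0 : R) < Num.sqrt 2 by rewrite sqrtr_gt0 ltr0n.
  have := ereal_inf_lbound (S := [set l%:E | l in [set l : R | 0 <= l /\ halfplane_condition rho HG l]]).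
  move=> /(_ (Num.sqrt 2 * l)%:E) h.
  have /h {}h : [set l%:E | l in [set l : R | 0 <= l /\ halfplane_condition rho HG l]] (Num.sqrt 2 * l)%:E.
    by exists (Num.sqrt 2 * l) => //; exact: cond_of sf lb.
  have -> : l%:E = ((Num.sqrt 2)^-1%:E * (Num.sqrt 2 * l)%:E)%E.
    by rewrite -EFinM mulrA mulVf ?mul1r // gt_eqF.
  by rewrite lee_wpmul2l // lee_fin invr_ge0 ltW.
rewrite -ereal_inf_pZl ?ltr0n //.
apply: le_ereal_inf_tmp => _ [_ [l [l0 cl] <-] <-].
have [f sf lf] := sel_of l l0 cl.
apply: le_trans (semi_le _ _ lf).
apply: ereal_inf_lbound; exists f => //; split=> //.
exact: le_lt_trans (semi_le _ _ lf) (ltry _).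
Qed.
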